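(* For $n\ge 0$, the leading term of the polynomial $P(S^n_R)$ in $R$ is proportional to the volume of the $n$-sphere $S^n_R$ and the constant term is equal to its Euler characteristic: precisely, writing $\omega_n$ for the volume of the unit $n$-ball, the leading term of $P(S^n_R)$ is $$\frac{\mathrm{vol}(S^n_1)\,R^n}{n!\,\omega_n}$$ and the constant term of $P(S^n_R)$ is $\chi(S^n_1)$.
   Context: $P(S^n_R)$ is the polynomial in $R$ (the numerator of the formula for the magnitude of the $n$-sphere of radius $R$ with its intrinsic metric) defined for $n\ge 0$ by $$P(S^n_R):=\begin{cases} 2\Bigl(\bigl(\frac{R}{n-1}\bigr)^2+1\Bigr)\Bigl(\bigl(\frac{R}{n-3}\bigr)^2+1\Bigr)\cdots\Bigl(\bigl(\frac{R}{1}\bigr)^2+1\Bigr) & \text{for } n \text{ even},\\ \pi R\Bigl(\bigl(\frac{R}{n-1}\bigr)^2+1\Bigr)\Bigl(\bigl(\frac{R}{n-3}\bigr)^2+1\Bigr)\cdots\Bigl(\bigl(\frac{R}{2}\bigr)^2+1\Bigr) & \text{for } n \text{ odd}, \end{cases}$$ where the product runs over denominators $n-1,n-3,\dots$ decreasing in steps of two down to $1$ ($n$ even) or $2$ ($n$ odd), and the empty product is interpreted as $1$ for $n=0$ and $n=1$. $S^n_R$ is the $n$-sphere of radius $R$, $\mathrm{vol}$ is its $n$-dimensional volume (number of points for $n=0$), and $\chi$ is the Euler characteristic. *)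

(* Defs.v *)
From HB Require Import structures.
From mathcomp Require Import all_boot all_order all_algebra.
From mathcomp Require Import all_classical all_reals all_analysis.

Set Implicit Arguments.
Unset Strict Implicit.
Unset Printing Implicit Defensive.

Import Order.TTheory GRing.Theory Num.Theory.
Import numFieldNormedType.Exports.

Local Open Scope classical_set_scope.
Local Open Scope ring_scope.

(* The numerator P(S^n_R), as a polynomial in the radius R. *)
Definition magnitude_numerator (R : realType) (n : nat) : {poly R} :=
  if odd n then
    pi *: 'X * \prod_(1 <= j < n | ~~ odd j) ((j%:R^-1 *: 'X) ^+ 2 + 1)
  else
    2 *: \prod_(1 <= j < n | odd j) ((j%:R^-1 *: 'X) ^+ 2 + 1).

Definition leading_term (R : realType) (p : {poly R}) : {poly R} :=
  lead_coef p *: 'X^((size p).-1).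

(* The library norm on row vectors is the sup norm; the geometry below is
   Euclidean (both induce the same topology). *)
Definition enorm (R : realType) (k : nat) (x : 'rV[R]_k) : R :=
  Num.sqrt (\sum_(i < k) x 0 i ^+ 2).

Definition open_unit_ball (R : realType) (k : nat) : set 'rV[R]_k :=
  [set x | enorm x < 1].
Arguments open_unit_ball R k : clear implicits.

Definition closed_unit_ball (R : realType) (k : nat) : set 'rV[R]_k :=
  [set x | enorm x <= 1].
Arguments closed_unit_ball R k : clear implicits.

(* The (k - 1)-dimensional sphere of R^k; it is empty for k = 0 and r != 0. *)
Definition esphere (R : realType) (k : nat) (r : R) : set 'rV[R]_k :=
  [set x | enorm x = r].
Arguments esphere {R} k r.

Definition sphere (R : realType) (n : nat) (r : R) : set 'rV[R]_n.+1 :=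
  esphere n.+1 r.
Arguments sphere {R} n r.

Definition unit_cube (R : realType) (k : nat) : set 'rV[R]_k :=
  [set x | forall i, 0 <= x 0 i <= 1].
Arguments unit_cube R k : clear implicits.

(* Lebesgue measure on R^k by iterated slicing: the (k+1)-dimensional measure
   is the product of [lebesgue_measure] with the k-dimensional one, evaluated as
   in the library's [product_measure1].  This is the Lebesgue measure on Borel
   sets, the only sets to which it is applied. *)
Fixpoint lebesgue_vol (R : realType) (k : nat) : set 'rV[R]_k -> \bar R :=
  match k with
  | 0 => fun A => (\1_A (0 : 'rV[R]_0))%:E
  | k'.+1 => fun A =>
      (\int[lebesgue_measure]_(t in [set: R])
         @lebesgue_vol R k'
           [set x | A (row_mx (t%:M : 'rV[R]_1) x : 'rV[R]_(1 + k'))])%E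
  end.

(* omega_n, the volume of the unit ball of R^n. *)
Definition ball_volume (R : realType) (n : nat) : R :=
  fine (lebesgue_vol (closed_unit_ball R n)).

(* Euclidean diameter, -oo on the empty set. *)
Definition diam (R : realType) (m : nat) (E : set 'rV[R]_m) : \bar R :=
  ereal_sup [set (enorm (z.1 - z.2))%:E | z in E `*` E].

(* (diam E)^n, with the conventions 0^0 = 1 for a singleton and value 0 on the
   empty set, so that the case n = 0 below gives counting measure. *)
Definition diam_gauge (R : realType) (m n : nat) (E : set 'rV[R]_m) : \bar R :=
  if `[< E = set0 >] then 0%E else (diam E ^+ n)%E.

Definition hausdorff_premeasure (R : realType) (m n : nat) (delta : R)
    (A : set 'rV[R]_m) : \bar R :=
  ereal_inf
    [set (\sum_(0 <= k <oo) diam_gauge n (E k))%E | E in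
      [set E : nat -> set 'rV[R]_m |
        A `<=` \bigcup_k E k /\ forall k, (diam (E k) <= delta%:E)%E]].

(* n-dimensional Hausdorff measure on R^m, not normalised *)
Definition hausdorff_measure (R : realType) (m n : nat)
    (A : set 'rV[R]_m) : \bar R :=
  ereal_sup [set hausdorff_premeasure n delta A | delta in [set delta | 0 < delta]].

(* The n-dimensional volume of a subset of R^m: n-dimensional Hausdorff measure
   normalised so that the unit cube of R^n has volume 1 (on R^n itself it is then
   Lebesgue measure).  It is the Riemannian volume on n-dimensional submanifolds,
   whether distances are Euclidean or intrinsic, and the number of points for
   n = 0. *)
Definition volume (R : realType) (m n : nat) (A : set 'rV[R]_m) : R :=
  fine (hausdorff_measure n A) / fine (hausdorff_measure n (unit_cube R n)).

(* A finite CW structure on the subspace A of R^m, with cells indexed by 'I_N: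
   [d i] is the dimension and [Phi i] the characteristic map of the i-th cell.
   As A is Hausdorff and there are finitely many cells, the weak topology
   condition is automatic, and so is the fact that each Phi i restricts to a
   homeomorphism from the open ball onto the open cell. *)
Definition finite_cw_structure (R : realType) (m : nat) (A : set 'rV[R]_m)
    (N : nat) (d : 'I_N -> nat) (Phi : forall i, 'rV[R]_(d i) -> 'rV[R]_m) :
    Prop :=
  let cell i := Phi i @` open_unit_ball R (d i) in
  [/\ forall i, {within closed_unit_ball R (d i), continuous (Phi i)},
      forall i, set_inj (open_unit_ball R (d i)) (Phi i),
      A = \bigcup_i cell i,
      trivIset [set: 'I_N] cell
    & forall i, Phi i @` esphere (d i) 1 `<=`
        \bigcup_(j in [set j | (d j < d i)%N]) cell j].

(* chi is the Euler characteristic of A: the alternating sum of the numbers of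
   cells of a finite CW structure on A.  By the classical invariance theorem
   at most one chi satisfies this. *)
Definition is_euler_characteristic (R : realType) (m : nat)
    (A : set 'rV[R]_m) (chi : int) : Prop :=
  exists (N : nat) (d : 'I_N -> nat)
    (Phi : forall i, 'rV[R]_(d i) -> 'rV[R]_m),
    finite_cw_structure A Phi /\ chi = \sum_(i < N) (-1) ^+ d i.

(* Main.v *)
Require Import Defs.
From HB Require Import structures.
From mathcomp Require Import all_boot all_order all_algebra.
From mathcomp Require Import all_classical all_reals all_analysis.
From mathcomp Require Import measurable_realfun ring lra zify.

Set Implicit Arguments.
Unset Strict Implicit.
Unset Printing Implicit Defensive.

Import Order.TTheory GRing.Theory Num.Theory.
Import numFieldNormedType.Exports.

Local Open Scope classical_set_scope.
Local Open Scope ring_scope.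

(** Write C_m for the integral of cos^m over [-pi/2, pi/2] ([wallis]), so that
C_0 = pi, C_1 = 2 and C_(m+2) = (m+1)/(m+2) C_m.  Three quantities are expressed
through these numbers.

Slicing the unit ball by hyperplanes gives omega_n = C_1 ... C_n
([lebesgue_vol_ball]): the slice at height t of a ball of radius r is a ball of
radius sqrt (r^2 - t^2), and the substitution t = r sin theta turns the
resulting integral into r^(m+1) C_(m+1).

Cutting the sphere by circles of latitude gives
vol (S^n_1) = sigma_n = 2 C_0 ... C_(n-1) ([volume_sphere]).

The leading coefficient a_n of P(S^n_R) satisfies a_(n+2) = a_n / (n+1)^2, with
a_0 = 2 and a_1 = pi, and so does 2 pi / (n! C_n), so the two agree
([magnitude_numerator_lead]).

By the product formulas sigma_n C_n = 2 pi omega_n ([sphere_const_wallis]),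
hence a_n = sigma_n / (n! omega_n), which is the claim on the leading term.

The real work is the formula for sigma_n, where volume means normalised
Hausdorff measure.  The proof uses only that the Hausdorff measure H^s is
monotone, finitely subadditive, superadditive on sets at positive distance
([hausdorff_measure_separated]) and scales by at most L^s under L-Lipschitz maps
([hausdorff_measure_lipschitz]).  To let the recursion on n run, it is proved with a spectator cube:
H^(k+n) ([0,1]^k x S^n) = sigma_n H^(k+n) ([0,1]^(k+n)) for all k.  A thin
latitude band of [0,1]^k x S^(n+1), at latitudes in [a,b], is parametrised by
(x, t, u) |-> (x, sin t, cos t u); since

  |(x, sin s, cos s u) - (y, sin t, cos t v)|^2
     = |x - y|^2 + (sin s - sin t)^2 + (cos s - cos t)^2 + cos s cos t |u - v|^2

it is nearly isometric to [0,1]^k x [a,b] x (cos t) S^n, whose measure is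
(b - a) (cos t)^n times that of [0,1]^(k+1) x S^n: sub- and superadditivity
force the measure of a box times any set to be proportional to each side of the
box ([hausdorff_measure_box]).  Summing over the bands gives Riemann sums of
C_n.  The normalisation is legitimate because the unit cube has finite
([hausdorff_measure_unit_cube_lty]) and positive
([hausdorff_measure_unit_cube_gt0]) Hausdorff measure.

The constant term of P(S^n_R) is 2 for n even and 0 for n odd, that is
1 + (-1)^n, the Euler characteristic of the cell structure of S^n with one point
and one n-cell ([sphere_cw_structure]). *)

(** * The Euclidean norm *)

Lemma enorm_ge0 (R : realType) (k : nat) (x : 'rV[R]_k) : 0 <= enorm x.
Proof. exact: sqrtr_ge0. Qed.

Lemma enorm_sqr (R : realType) (k : nat) (x : 'rV[R]_k) :
  enorm x ^+ 2 = \sum_(i < k) x 0 i ^+ 2.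
Proof. by rewrite sqr_sqrtr // sumr_ge0 // => i _; exact: sqr_ge0. Qed.

Lemma enorm0 (R : realType) (k : nat) : enorm (0 : 'rV[R]_k) = 0.
Proof.
by rewrite /enorm big1 ?sqrtr0 // => i _; rewrite mxE expr0n.
Qed.

Lemma enormZ (R : realType) (k : nat) (a : R) (x : 'rV[R]_k) :
  enorm (a *: x) = `|a| * enorm x.
Proof.
rewrite /enorm -sqrtr_sqr -sqrtrM ?sqr_ge0 // mulr_sumr; congr Num.sqrt.
by apply: eq_bigr => i _; rewrite mxE exprMn.
Qed.

Lemma enorm_row_mx_sqr (R : realType) (k p : nat)
    (x : 'rV[R]_k) (y : 'rV[R]_p) :
  enorm (row_mx x y) ^+ 2 = enorm x ^+ 2 + enorm y ^+ 2.
Proof.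
rewrite !enorm_sqr big_split_ord /=; congr (_ + _); apply: eq_bigr => i _.
  by rewrite row_mxEl.
by rewrite row_mxEr.
Qed.

Lemma enorm_scalar_sqr (R : realType) (a : R) :
  enorm (a%:M : 'rV[R]_1) ^+ 2 = a ^+ 2.
Proof. by rewrite enorm_sqr big_ord1 mxE eqxx. Qed.

Lemma row_mxB (R : realType) (k p : nat) (x x' : 'rV[R]_k) (y y' : 'rV[R]_p) :
  row_mx x y - row_mx x' y' = row_mx (x - x') (y - y').
Proof. by rewrite opp_row_mx add_row_mx. Qed.

Lemma ler_enorm (R : realType) (k p : nat) (x : 'rV[R]_k) (y : 'rV[R]_p) :
  enorm x ^+ 2 <= enorm y ^+ 2 -> enorm x <= enorm y.
Proof. by rewrite ler_sqr // nnegrE enorm_ge0. Qed.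

Lemma coord_le_enorm (R : realType) (k : nat) (x : 'rV[R]_k) (i : 'I_k) :
  `|x 0 i| <= enorm x.
Proof.
rewrite -(@ler_sqr R) ?nnegrE ?enorm_ge0 // enorm_sqr real_normK ?num_real //.
by rewrite (bigD1 i) //= lerDl sumr_ge0 // => j _; exact: sqr_ge0.
Qed.

(** * Elementary properties of Hausdorff measure *)

Lemma diam_ge0 (R : realType) (m : nat) (E : set 'rV[R]_m) :
  E !=set0 -> (0 <= diam E)%E.
Proof.
move=> [x Ex]; apply: ereal_sup_ubound; exists (x, x) => //=.
by rewrite subrr enorm0.
Qed.

Lemma diam_gauge_ge0 (R : realType) (m n : nat) (E : set 'rV[R]_m) :
  (0 <= diam_gauge n E)%E.
Proof.
rewrite /diam_gauge; case: asboolP => // /eqP /set0P E0.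
exact/expe_ge0/diam_ge0.
Qed.

Lemma diam_gauge0 (R : realType) (m n : nat) :
  diam_gauge n (set0 : set 'rV[R]_m) = 0%E.
Proof. by rewrite /diam_gauge; case: asboolP. Qed.

Lemma diam_set0 (R : realType) (m : nat) :
  diam (set0 : set 'rV[R]_m) = -oo%E.
Proof. by rewrite /diam set0X image_set0 ereal_sup0. Qed.

Lemma lee_expe (R : realType) (n : nat) (x y : \bar R) :
  (0 <= x -> x <= y -> x ^+ n <= y ^+ n)%E.
Proof.
move=> x0 xy; elim: n => [|n IH]; rewrite ?expe0 ?expeS //.
by apply: lee_pmul => //; exact: expe_ge0.
Qed.

Lemma diam_le (R : realType) (m : nat) (E : set 'rV[R]_m) (d : \bar R) :
  (forall x y, E x -> E y -> ((enorm (x - y))%:E <= d)%E) -> (diam E <= d)%E.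
Proof. by move=> H; apply/ereal_supP => _ [[x y] /= [Ex Ey] <-]; exact: H. Qed.

Lemma enorm_le_diam (R : realType) (m : nat) (E : set 'rV[R]_m)
    (x y : 'rV[R]_m) : E x -> E y -> ((enorm (x - y))%:E <= diam E)%E.
Proof. by move=> Ex Ey; apply: ereal_sup_ubound; exists (x, y). Qed.

Lemma le_add_ereal_inf (R : realType) (X Y : set (\bar R)) (z : \bar R) :
  (forall x, X x -> (0 <= x)%E) -> (forall y, Y y -> (0 <= y)%E) ->
  (forall x y, X x -> Y y -> (z <= x + y)%E) ->
  (z <= ereal_inf X + ereal_inf Y)%E.
Proof.
move=> X0 Y0 H.
have iX0 : (0 <= ereal_inf X)%E by apply/ereal_infP.
have iY0 : (0 <= ereal_inf Y)%E by apply/ereal_infP.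
have [->|Xy] := eqVneq (ereal_inf X) +oo%E.
  by rewrite addye ?leey// gt_eqF// (lt_le_trans _ iY0) ?ltNy0.
have [->|Yy] := eqVneq (ereal_inf Y) +oo%E.
  by rewrite addey ?leey// gt_eqF// (lt_le_trans _ iX0) ?ltNy0.
have fX : ereal_inf X \is a fin_num by rewrite ge0_fin_numE // ltey.
have fY : ereal_inf Y \is a fin_num by rewrite ge0_fin_numE // ltey.
apply/lee_addgt0Pr => e e0.
have e20 : 0 < e / 2 by rewrite divr_gt0.
have [x Xx xe] := lb_ereal_inf_adherent e20 fX.
have [y Yy' ye] := lb_ereal_inf_adherent e20 fY.
apply: (le_trans (H _ _ Xx Yy')).
apply: (le_trans (leeD (ltW xe) (ltW ye))).
by rewrite addeACA -EFinD -splitr.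
Qed.

Lemma add_ereal_sup_le (R : realType) (X Y : set (\bar R)) (z : \bar R) :
  X !=set0 -> Y !=set0 ->
  (forall x, X x -> (0 <= x)%E) -> (forall y, Y y -> (0 <= y)%E) ->
  (forall x y, X x -> Y y -> (x + y <= z)%E) ->
  (ereal_sup X + ereal_sup Y <= z)%E.
Proof.
move=> [x0 Xx0] [y0 Yy0] X0 Y0 H.
have [->|zy] := eqVneq z +oo%E; first exact: leey.
have fz : z \is a fin_num.
  rewrite ge0_fin_numE ?ltey //; apply: le_trans (H _ _ Xx0 Yy0).
  by apply: adde_ge0; [exact: X0 | exact: Y0].
have fX x : X x -> x \is a fin_num.
  move=> Xx; rewrite ge0_fin_numE ?X0 //; apply: (@le_lt_trans _ _ z).
    by apply: le_trans (H _ _ Xx Yy0); rewrite leeDl // Y0.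
  by rewrite ltey.
have fY y : Y y -> y \is a fin_num.
  move=> Yy; rewrite ge0_fin_numE ?Y0 //; apply: (@le_lt_trans _ _ z).
    by apply: le_trans (H _ _ Xx0 Yy); rewrite leeDr // X0.
  by rewrite ltey.
have sX y : Y y -> (ereal_sup X <= z - y)%E.
  by move=> Yy; apply/ereal_supP => x Xx; rewrite leeBrDr ?fY // H.
have fsX : ereal_sup X \is a fin_num.
  rewrite ge0_fin_numE; last first.
    by apply: (le_trans (X0 _ Xx0)); exact: ereal_sup_ubound.
  apply: (le_lt_trans (sX _ Yy0)).
  by rewrite ltey_eq fin_numB fz fY.
rewrite addeC -leeBrDr //; apply/ereal_supP => y Yy.
by rewrite leeBrDr // addeC -leeBrDr ?fY // sX.
Qed.

Lemma hausdorff_premeasure_ge0 (R : realType) (m n : nat) (delta : R)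
    (A : set 'rV[R]_m) : (0 <= hausdorff_premeasure n delta A)%E.
Proof.
apply/ereal_infP => _ [E _ <-]; apply: nneseries_ge0 => k _ _.
exact: diam_gauge_ge0.
Qed.

Lemma hausdorff_premeasure_le_measure (R : realType) (m n : nat) (delta : R)
    (A : set 'rV[R]_m) : 0 < delta ->
  (hausdorff_premeasure n delta A <= hausdorff_measure n A)%E.
Proof. by move=> d0; apply: ereal_sup_ubound; exists delta. Qed.

Lemma hausdorff_measureP (R : realType) (m n : nat) (A : set 'rV[R]_m)
    (z : \bar R) :
  (forall delta, 0 < delta -> (hausdorff_premeasure n delta A <= z)%E) ->
  (hausdorff_measure n A <= z)%E.
Proof. by move=> H; apply/ereal_supP => _ [d /= d0 <-]; exact: H. Qed.

Lemma hausdorff_measure_ge0 (R : realType) (m n : nat)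
    (A : set 'rV[R]_m) : (0 <= hausdorff_measure n A)%E.
Proof.
apply: le_trans (hausdorff_premeasure_le_measure n A ltr01).
exact: hausdorff_premeasure_ge0.
Qed.

Lemma le_hausdorff_premeasure (R : realType) (m n : nat) (delta : R)
    (A B : set 'rV[R]_m) : A `<=` B ->
  (hausdorff_premeasure n delta A <= hausdorff_premeasure n delta B)%E.
Proof.
move=> AB; apply: ereal_inf_le_tmp => _ [E [BE dE] <-]; exists E => //; split=> //.
exact: subset_trans BE.
Qed.

Lemma hausdorff_premeasure_anti (R : realType) (m n : nat) (d d' : R)
    (A : set 'rV[R]_m) : d' <= d ->
  (hausdorff_premeasure n d A <= hausdorff_premeasure n d' A)%E.
Proof.
move=> dd; apply: ereal_inf_le_tmp => _ [E [BE dE] <-]; exists E => //; split=> //.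
by move=> k; apply: le_trans (dE k) _; rewrite lee_fin.
Qed.

Lemma le_hausdorff_measure (R : realType) (m n : nat)
    (A B : set 'rV[R]_m) : A `<=` B ->
  (hausdorff_measure n A <= hausdorff_measure n B)%E.
Proof.
move=> AB; apply: hausdorff_measureP => d d0.
apply: le_trans (hausdorff_premeasure_le_measure n B d0).
exact: le_hausdorff_premeasure.
Qed.

(** Two covers are merged into a single sequence by alternating their members;
the partial sums of even length of the merged series split exactly. *)
Lemma sum_interleave_le (R : realType) (u v : nat -> \bar R) :
  (forall k, (0 <= u k)%E) -> (forall k, (0 <= v k)%E) ->
  (\sum_(0 <= k <oo) (if odd k then v k./2 else u k./2) <=
   \sum_(0 <= k <oo) u k + \sum_(0 <= k <oo) v k)%E.
Proof.
move=> u0 v0; pose w k := if odd k then v k./2 else u k./2.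
have w0 k : (0 <= w k)%E by rewrite /w; case: ifP.
have sumE N : (\sum_(0 <= k < N.*2) w k =
    \sum_(0 <= k < N) u k + \sum_(0 <= k < N) v k)%E.
  elim: N => [|N IH]; first by rewrite !big_geq // adde0.
  rewrite doubleS !big_nat_recr //= IH /w /= odd_double /=.
  by rewrite doubleK uphalf_double -addeA addeACA.
apply: lime_le; first by apply: is_cvg_nneseries => k _ _; exact: w0.
apply: nearW => N.
apply: (@le_trans _ _ (\sum_(0 <= k < N.*2) w k)%E).
  by apply: (@lee_sum_nneg_natr R w xpredT 0) => [k _ _|]; rewrite -?addnn ?leq_addr.
rewrite sumE; apply: leeD; apply: nneseries_lim_ge => //.
Qed.

Lemma hausdorff_premeasureU (R : realType) (m n : nat) (delta : R)
    (A B : set 'rV[R]_m) :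
  (hausdorff_premeasure n delta (A `|` B) <=
   hausdorff_premeasure n delta A + hausdorff_premeasure n delta B)%E.
Proof.
apply: le_add_ereal_inf.
- by move=> _ [E _ <-]; apply: nneseries_ge0 => k _ _; exact: diam_gauge_ge0.
- by move=> _ [E _ <-]; apply: nneseries_ge0 => k _ _; exact: diam_gauge_ge0.
move=> _ _ [E [AE dE] <-] [F [BF dF] <-].
pose G k := if odd k then F k./2 else E k./2.
apply: (@le_trans _ _ (\sum_(0 <= k <oo) diam_gauge n (G k))%E).
  apply: ereal_inf_lbound; exists G => //; split=> [x [/AE|/BF] [k _ Hk]|k].
  - by exists k.*2 => //; rewrite /G odd_double doubleK.
  - by exists k.*2.+1 => //; rewrite /G /= odd_double /= uphalf_double.
  - by rewrite /G; case: ifP.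
apply: le_trans (sum_interleave_le _ _); last 2 first.
- by move=> k; exact: diam_gauge_ge0.
- by move=> k; exact: diam_gauge_ge0.
apply: lee_nneseries => [k _ _|k _]; first exact: diam_gauge_ge0.
by rewrite /G; case: ifP.
Qed.

Lemma hausdorff_measureU (R : realType) (m n : nat) (A B : set 'rV[R]_m) :
  (hausdorff_measure n (A `|` B) <=
   hausdorff_measure n A + hausdorff_measure n B)%E.
Proof.
apply: hausdorff_measureP => d d0.
apply: (le_trans (hausdorff_premeasureU _ _ _ _)).
by apply: leeD; exact: hausdorff_premeasure_le_measure.
Qed.

(** A set of diameter less than [eta] cannot meet both [A] and [B], so a
fine enough cover of the union splits into a cover of [A] and a cover of [B]. *)
Lemma hausdorff_measure_separated (R : realType) (m n : nat) (eta : R)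
    (A B : set 'rV[R]_m) : 0 < eta ->
  (forall x y, A x -> B y -> eta <= enorm (x - y)) ->
  (hausdorff_measure n A + hausdorff_measure n B <=
   hausdorff_measure n (A `|` B))%E.
Proof.
move=> eta0 sep.
have key d : 0 < d -> d < eta ->
    (hausdorff_premeasure n d A + hausdorff_premeasure n d B <=
     hausdorff_measure n (A `|` B))%E.
  move=> d0 de; apply: le_trans (hausdorff_premeasure_le_measure n _ d0).
  apply/ereal_infP => _ [E [ABE dE] <-].
  (* The members of the cover that meet C. *)
  pose F C k := if `[< E k `&` C !=set0 >] then E k else set0.
  have FP (C : set 'rV[R]_m) : C `<=` A `|` B ->
      (hausdorff_premeasure n d C <= \sum_(0 <= k <oo) diam_gauge n (F C k))%E.
    move=> CAB; apply: ereal_inf_lbound; exists (F C) => //; split=> [x Cx|k].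
      have [k _ Ek] := ABE _ (CAB _ Cx); exists k => //; rewrite /F.
      by case: asboolP => //; case; exists x.
    by rewrite /F; case: ifP => // _; rewrite diam_set0 leNye.
  apply: (le_trans (leeD (FP A (@subsetUl _ _ _)) (FP B (@subsetUr _ _ _)))).
  rewrite -nneseriesD; [|by move=> *; exact: diam_gauge_ge0..].
  apply: lee_nneseries => [k _ _|k _].
    by apply: adde_ge0; exact: diam_gauge_ge0.
  rewrite /F; case: asboolP => [[x [Ex Ax]]|_]; last first.
    by rewrite diam_gauge0 add0e; case: ifP; rewrite ?diam_gauge0 ?diam_gauge_ge0.
  case: asboolP => [[y [Ey By]]|_]; last by rewrite diam_gauge0 adde0.
  have := le_trans (enorm_le_diam Ex Ey) (dE k).
  by rewrite lee_fin leNgt (lt_le_trans de (sep _ _ Ax By)).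
apply: add_ereal_sup_le.
- by exists (hausdorff_premeasure n 1 A); exists 1 => //=.
- by exists (hausdorff_premeasure n 1 B); exists 1 => //=.
- by move=> _ [d _ <-]; exact: hausdorff_premeasure_ge0.
- by move=> _ [d _ <-]; exact: hausdorff_premeasure_ge0.
move=> _ _ [d1 /= d10 <-] [d2 /= d20 <-].
pose d := Num.min (Num.min d1 d2) (eta / 2).
have d0 : 0 < d by rewrite !lt_min d10 d20 divr_gt0.
have de : d < eta by rewrite gt_min ltr_pdivrMr // mulr_natr mulr2n ltrDl eta0 orbT.
apply: le_trans (key d d0 de); apply: leeD; apply: hausdorff_premeasure_anti.
  by rewrite !ge_min lexx.
by rewrite !ge_min lexx orbT.
Qed.

(** Both sets are given by maps from a common parameter set, so that neither a
map nor an inverse between the sets themselves has to be constructed: a cover of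
[psi @` D] is pulled back to [D] and pushed forward by [phi]. *)
Lemma hausdorff_premeasure_lipschitz (R : realType) (T : Type) (m p n : nat)
    (L d : R) (D : set T) (phi : T -> 'rV[R]_m) (psi : T -> 'rV[R]_p) : 0 < L ->
  (forall x y, D x -> D y ->
    enorm (phi x - phi y) <= L * enorm (psi x - psi y)) ->
  (hausdorff_premeasure n (L * d) (phi @` D) <=
   (L ^+ n)%:E * hausdorff_premeasure n d (psi @` D))%E.
Proof.
move=> L0 lip.
rewrite /hausdorff_premeasure -ereal_inf_pZl ?exprn_gt0 //.
apply/ereal_infP => _ [_ [E [DE dE] <-] <-].
pose F k := phi @` (D `&` psi @^-1` (E k)).
have dF k : (diam (F k) <= L%:E * diam (E k))%E.
  apply: diam_le => _ _ [x [Dx Ex] <-] [y [Dy Ey] <-].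
  apply: (@le_trans _ _ (L%:E * (enorm (psi x - psi y))%:E)%E).
    by rewrite -EFinM lee_fin lip.
  apply: lee_wpmul2l; first by rewrite lee_fin ltW.
    exact: enorm_le_diam.
apply: (@le_trans _ _ (\sum_(0 <= k <oo) diam_gauge n (F k))%E).
  apply: ereal_inf_lbound; exists F => //; split=> [_ [x Dx <-]|k].
    by have [|k _ Ek] := DE (psi x); [exists x | exists k => //; exists x].
  apply: (le_trans (dF k)); rewrite EFinM.
  by apply: lee_wpmul2l => //; rewrite lee_fin ltW.
rewrite -nneseriesZl; last by move=> *; exact: diam_gauge_ge0.
apply: lee_nneseries => [k _ _|k _]; first exact: diam_gauge_ge0.
have [->|/set0P F0] := eqVneq (F k) set0.
  rewrite diam_gauge0; apply: mule_ge0; last exact: diam_gauge_ge0.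
  by rewrite lee_fin exprn_ge0 // ltW.
rewrite /diam_gauge; case: asboolP => [/eqP|_]; first by move/set0P: F0 => /negP.
have E0 : E k !=set0 by case: F0 => _ [x [_ Ex] _]; exists (psi x).
case: asboolP => [/eqP|_]; first by move/set0P: E0 => /negP.
apply: (le_trans (lee_expe n (diam_ge0 F0) (dF k))).
have := dE k; have := diam_ge0 E0.
case: (diam (E k)) => [r _ _||] //=.
by rewrite -EFinM -!EFin_expe -EFinM exprMn.
Qed.

Lemma hausdorff_measure_lipschitz (R : realType) (T : Type) (m p n : nat)
    (L : R) (D : set T) (phi : T -> 'rV[R]_m) (psi : T -> 'rV[R]_p) : 0 < L ->
  (forall x y, D x -> D y ->
    enorm (phi x - phi y) <= L * enorm (psi x - psi y)) ->
  (hausdorff_measure n (phi @` D) <=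
   (L ^+ n)%:E * hausdorff_measure n (psi @` D))%E.
Proof.
move=> L0 lip; apply: hausdorff_measureP => d d0.
have -> : d = L * (d / L) by rewrite mulrC divfK // gt_eqF.
apply: (le_trans (hausdorff_premeasure_lipschitz _ _ L0 lip)).
apply: lee_wpmul2l; first by rewrite lee_fin exprn_ge0 // ltW.
by apply: hausdorff_premeasure_le_measure; rewrite divr_gt0.
Qed.

(** * Similarities, translations and boxes *)

Lemma hausdorff_measure_similar (R : realType) (T : Type) (m p n : nat)
    (r : R) (D : set T) (phi : T -> 'rV[R]_m) (psi : T -> 'rV[R]_p) : 0 < r ->
  (forall x y, D x -> D y ->
    enorm (phi x - phi y) = r * enorm (psi x - psi y)) ->
  (hausdorff_measure n (phi @` D) =
   (r ^+ n)%:E * hausdorff_measure n (psi @` D))%E.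
Proof.
move=> r0 sim; apply/eqP; rewrite eq_le; apply/andP; split.
  by apply: hausdorff_measure_lipschitz => // x y Dx Dy; rewrite sim.
have rV0 : 0 < r^-1 by rewrite invr_gt0.
rewrite muleC -lee_pdivlMr ?exprn_gt0 // muleC -exprVn.
apply: hausdorff_measure_lipschitz => // x y Dx Dy.
by rewrite sim // mulKf // gt_eqF.
Qed.

Lemma hausdorff_measure_isometric (R : realType) (T : Type) (m p n : nat)
    (D : set T) (phi : T -> 'rV[R]_m) (psi : T -> 'rV[R]_p) :
  (forall x y, D x -> D y -> enorm (phi x - phi y) = enorm (psi x - psi y)) ->
  hausdorff_measure n (phi @` D) = hausdorff_measure n (psi @` D).
Proof.
move=> iso; rewrite (@hausdorff_measure_similar _ _ _ _ n 1 D phi psi) //.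
  by rewrite expr1n mul1e.
by move=> x y Dx Dy; rewrite iso // mul1r.
Qed.

Lemma hausdorff_measure_translate (R : realType) (m n : nat) (v : 'rV[R]_m)
    (A : set 'rV[R]_m) :
  hausdorff_measure n ((fun z => z + v) @` A) = hausdorff_measure n A.
Proof.
rewrite (@hausdorff_measure_isometric _ _ _ m n A (fun z => z + v) id).
  by rewrite image_id.
by move=> x y _ _; rewrite opprD addrACA subrr addr0.
Qed.

(** Let [f x] be the size of an interval of length [x].  Adjacent intervals are
covered by subadditivity; superadditivity is assumed only with a gap, since
measures are known to add up only for sets at positive distance.  If
b < (M+1) x and (N+1) x < a, then f b <= (M+1) f x and (N+1) f x <= f a, so
f b <= (M+1)/(N+1) f a, and (M+1)/(N+1) can be taken arbitrarily close to b / a.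
Exchanging a and b shows that [f] is linear. *)
Lemma interval_function_ratio_le (R : realType) (f : R -> \bar R) :
  (forall x : R, 0 <= f x)%E ->
  (forall x y : R, 0 < x -> 0 < y -> (f (x + y)%R <= f x + f y)%E) ->
  (forall x y z : R, 0 < x -> 0 < y -> x + y < z -> (f x + f y <= f z)%E) ->
  forall a b : R, 0 < a -> 0 < b -> (f b <= (b / a)%:E * f a)%E.
Proof.
move=> f0 fsub fsup a b a0 b0.
have fmono (x z : R) : 0 < x -> x < z -> (f x <= f z)%E.
  move=> x0 xz; apply: (@le_trans _ _ (f x + f ((z - x) / 2)%R)%E).
    by rewrite leeDl.
  by apply: fsup => //; lra.
have fM M (x : R) : 0 < x -> (f (M.+1%:R * x)%R <= M.+1%:R%:E * f x)%E.
  move=> x0; elim: M => [|M IH]; first by rewrite mul1r mul1e.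
  have -> : M.+2%:R * x = M.+1%:R * x + x by rewrite -[M.+2]addn1 natrD mulrDl mul1r.
  apply: (le_trans (fsub _ _ _ _)) => //; first by rewrite mulr_gt0.
  rewrite -[M.+2%:R]natr1 EFinD ge0_muleDl ?lee_fin // mul1e.
  exact: leeD.
have fN N (x z : R) : 0 < x -> N.+1%:R * x < z -> (N.+1%:R%:E * f x <= f z)%E.
  move=> x0; elim: N z => [|N IH] z.
    by rewrite mul1r mul1e; exact: fmono.
  move=> xz.
  have H : N.+2%:R * x = N.+1%:R * x + x by rewrite -[N.+2]addn1 natrD mulrDl mul1r.
  pose w := (z - x + N.+1%:R * x) / 2.
  rewrite H in xz.
  have Nx0 : 0 < N.+1%:R * x by rewrite mulr_gt0.
  have w1 : N.+1%:R * x < w by rewrite /w; lra.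
  apply: (@le_trans _ _ (f w + f x)%E); last by apply: fsup => //; rewrite /w; lra.
  rewrite -natr1 EFinD ge0_muleDl ?lee_fin // mul1e.
  by apply: leeD => //; exact: IH.
have key N : (f b <= (b / a + N.+1%:R^-1)%:E * f a)%E.
  (* (M+1) / (N+1) exceeds b / a by at most 1 / (N+1). *)
  pose M := Num.truncn (N.+1%:R * (b / a)).
  have ba0 : 0 < b / a by rewrite divr_gt0.
  have /truncn_itv/andP[M1 M2] : 0 <= N.+1%:R * (b / a) by rewrite mulr_ge0 // ltW.
  rewrite -/M in M1 M2.
  have N0 : 0 < N.+1%:R :> R by [].
  have M0 : 0 < M.+1%:R :> R by [].
  have lt1 : b / M.+1%:R < a / N.+1%:R.
    rewrite ltr_pdivrMr // mulrAC ltr_pdivlMr //.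
    by move: M2; rewrite mulrA ltr_pdivrMr // mulrC [X in _ < X]mulrC.
  have bM0 : 0 < b / M.+1%:R by rewrite divr_gt0.
  pose x := (b / M.+1%:R + a / N.+1%:R) / 2.
  have [bMx xaN] : b / M.+1%:R < x /\ x < a / N.+1%:R by rewrite /x; split; rewrite midf_lt.
  have x0 : 0 < x by exact: lt_trans bMx.
  have bx : b < M.+1%:R * x by rewrite mulrC -ltr_pdivrMr.
  have xa : N.+1%:R * x < a by rewrite mulrC -ltr_pdivlMr.
  have fx : (f x <= N.+1%:R^-1%:E * f a)%E.
    by rewrite muleC lee_pdivlMr // muleC; exact: fN.
  apply: (le_trans (fmono _ _ b0 bx)); apply: (le_trans (fM M _ x0)).
  apply: (@le_trans _ _ (M.+1%:R%:E * (N.+1%:R^-1%:E * f a))%E).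
    by apply: lee_wpmul2l.
  rewrite muleA -EFinM; apply: lee_wpmul2r => //; rewrite lee_fin.
  rewrite ler_pdivrMr // mulrDl mulVf ?gt_eqF // -natr1 lerD2r.
  by rewrite mulrC.
have [->|fay] := eqVneq (f a) +oo%E.
  by rewrite gt0_muley ?leey // lte_fin divr_gt0.
have fa : f a \is a fin_num by rewrite ge0_fin_numE // ltey.
rewrite -(fineK fa); set r := fine (f a).
have r0 : 0 <= r by rewrite fine_ge0.
apply/lee_addgt0Pr => e e0.
have [N rN] : exists N, r / e < N.+1%:R.
  by exists (Num.truncn (r / e)); apply: truncnS_gt.
apply: (le_trans (key N)); rewrite -(fineK fa) -/r -EFinM -EFinD lee_fin.
by rewrite mulrDl lerD2l mulrC ler_pdivrMr // mulrC -ler_pdivrMr // ltW.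
Qed.

Definition cbox (R : realType) (k : nat) (l : 'I_k -> R) : set 'rV[R]_k :=
  [set x | forall i, 0 <= x 0 i <= l i].

Definition row_prod (R : realType) (k p : nat) (A : set 'rV[R]_k)
    (B : set 'rV[R]_p) : set 'rV[R]_(k + p) :=
  [set row_mx z.1 z.2 | z in A `*` B].

(** Sides of a box are treated one at a time, each being the length of the
interval function of [interval_function_ratio_le]. *)
Definition set_side (R : realType) (k : nat) (l : 'I_k -> R) (i : 'I_k) (b : R)
  : 'I_k -> R := fun j => if j == i then b else l j.

Lemma hausdorff_measure_box_side_le (R : realType) (k p n : nat) (l : 'I_k -> R)
    (i : 'I_k) (B : set 'rV[R]_p) (a b : R) : 0 < a -> 0 < b ->
  (hausdorff_measure n (row_prod (cbox (set_side l i b)) B) <=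
   (b / a)%:E * hausdorff_measure n (row_prod (cbox (set_side l i a)) B))%E.
Proof.
move: a b; apply: interval_function_ratio_le => [x|x y x0 y0|x y z x0 y0 xyz].
- exact: hausdorff_measure_ge0.
- pose v : 'rV[R]_(k + p) := row_mx (x *: delta_mx 0 i) 0.
  rewrite -(hausdorff_measure_translate n v (row_prod (cbox (set_side l i y)) B)).
  apply: le_trans (hausdorff_measureU _ _ _).
  apply: le_hausdorff_measure => _ [[u w] /= [bu Bw] <-].
  have [ux|ux] := leP (u 0 i) x.
    left; exists (u, w) => //; split=> //= j.
    by have := bu j; rewrite /set_side; case: eqP => // -> /andP[-> _].
  right; exists (row_mx (u - x *: delta_mx 0 i) w); last first.
    by rewrite add_row_mx subrK addr0.
  exists (u - x *: delta_mx 0 i, w) => //; split=> //= j.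
  have := bu j; rewrite /set_side !mxE eqxx /=; case: eqP => [->|_] /=.
    by rewrite mulr1 subr_ge0 (ltW ux) lerBlDl => /andP[].
  by rewrite mulr0 subr0.
pose v : 'rV[R]_(k + p) := row_mx ((z - y) *: delta_mx 0 i) 0.
rewrite -(hausdorff_measure_translate n v (row_prod (cbox (set_side l i y)) B)).
apply: (@le_trans _ _ (hausdorff_measure n
   (row_prod (cbox (set_side l i x)) B `|`
    [set z0 + v | z0 in row_prod (cbox (set_side l i y)) B]))).
  apply: (@hausdorff_measure_separated _ _ _ (z - y - x)); first by lra.
  move=> _ _ [[u w] /= [bu _] <-] [_ [[u' w'] /= [bu' _] <-] <-].
  have := coord_le_enorm (row_mx u w - (row_mx u' w' + v)) (lshift p i).
  apply: le_trans; rewrite /v add_row_mx row_mxB row_mxEl !mxE !eqxx /= mulr1.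
  have := bu i; have := bu' i; rewrite /set_side eqxx => /andP[h1 h2] /andP[h3 h4].
  by rewrite ler0_norm; lra.
apply: le_hausdorff_measure => q [[[u w] /= [bu Bw] <-]|].
  exists (u, w) => //; split=> //= j; have := bu j.
  by rewrite /set_side; case: eqP => // _ /andP[-> /= h]; lra.
move=> [_ [[u w] /= [bu Bw] <-] <-].
exists (u + (z - y) *: delta_mx 0 i, w); last by rewrite add_row_mx addr0.
split=> //= j; have := bu j; rewrite /set_side !mxE eqxx /=.
case: eqP => [->|_] /=; last by rewrite mulr0 addr0.
by rewrite mulr1 => /andP[h1 h2]; apply/andP; split; lra.
Qed.

(** The sides are rescaled one after the other, each by the linearity of the
measure in the length of that side. *)
Lemma hausdorff_measure_box (R : realType) (k p n : nat) (l : 'I_k -> R)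
    (B : set 'rV[R]_p) : (forall i, 0 < l i) ->
  (hausdorff_measure n (row_prod (cbox l) B) =
   (\prod_i l i)%:E * hausdorff_measure n (row_prod (unit_cube R k) B))%E.
Proof.
move=> l0.
(* The unit cube is turned into the box by changing the sides listed in s. *)
pose mix (s : seq 'I_k) i := if i \in s then l i else 1.
have key s : uniq s -> (hausdorff_measure n (row_prod (cbox (mix s)) B) =
   (\prod_(i <- s) l i)%:E * hausdorff_measure n (row_prod (unit_cube R k) B))%E.
  elim: s => [|i s IH] /=; first by rewrite big_nil mul1e.
  move=> /andP[nis us]; rewrite big_cons EFinM -muleA -IH //.
  have -> : mix (i :: s) = set_side (mix s) i (l i).
    by apply/funext => j; rewrite /set_side /mix inE; case: eqP => [->|].
  have -> : mix s = set_side (mix s) i 1.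
    apply/funext => j; rewrite /set_side /mix; case: eqP => [->|] //.
    by rewrite (negbTE nis).
  have -> : set_side (set_side (mix s) i 1) i (l i) = set_side (mix s) i (l i).
    by apply/funext => j; rewrite /set_side; case: eqP.
  apply/eqP; rewrite eq_le; apply/andP; split.
    have := hausdorff_measure_box_side_le n (mix s) i B ltr01 (l0 i).
    by rewrite divr1.
  rewrite muleC -lee_pdivlMr // muleC.
  have := hausdorff_measure_box_side_le n (mix s) i B (l0 i) ltr01.
  by rewrite div1r.
rewrite -key ?index_enum_uniq //; congr (hausdorff_measure n (row_prod (cbox _) B)).
by apply/funext => i; rewrite /mix mem_index_enum.
Qed.

(** * The Hausdorff measure of the unit cube *)

Lemma hausdorff_premeasure_le_gauge (R : realType) (m n : nat) (delta : R)
    (A : set 'rV[R]_m) : (diam A <= delta%:E)%E ->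
  (hausdorff_premeasure n delta A <= diam_gauge n A)%E.
Proof.
move=> dA; pose E k : set 'rV[R]_m := if k is 0 then A else set0.
apply: (@le_trans _ _ (\sum_(0 <= k <oo) diam_gauge n (E k))%E).
  apply: ereal_inf_lbound; exists E => //; split=> [x Ax|[|k]] //.
    by exists 0%N.
  by rewrite /= diam_set0 leNye.
apply: lime_le; first by apply: is_cvg_nneseries => k _ _; exact: diam_gauge_ge0.
apply: nearW => -[|N]; first by rewrite big_geq // diam_gauge_ge0.
rewrite big_nat_recl // big1_seq ?adde0 //= => i _.
exact: diam_gauge0.
Qed.

Lemma hausdorff_premeasure_bigcup (R : realType) (m n : nat) (delta : R)
    (I : Type) (s : seq I) (A : I -> set 'rV[R]_m) :
  (hausdorff_premeasure n delta (\big[setU/set0]_(i <- s) A i) <=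
   \sum_(i <- s) hausdorff_premeasure n delta (A i))%E.
Proof.
elim: s => [|i s IH]; last first.
  rewrite !big_cons; apply: (le_trans (hausdorff_premeasureU _ _ _ _)).
  exact: leeD.
rewrite !big_nil; apply: (le_trans (hausdorff_premeasure_le_gauge _ _)).
  by rewrite diam_set0 leNye.
by rewrite diam_gauge0.
Qed.

(** The grid of mesh 1 / (N+1) covers the cube by at most (2 (N+1))^k cells of
diameter at most k / (N+1). *)
Lemma hausdorff_measure_unit_cube_lty (R : realType) (k : nat) :
  (hausdorff_measure k (unit_cube R k) < +oo)%E.
Proof.
apply: (@le_lt_trans _ _ ((2 * k%:R) ^+ k)%:E); last exact: ltry.
apply: hausdorff_measureP => d d0.
have [N rN] : exists N, k%:R / d < N.+1%:R.
  by exists (Num.truncn (k%:R / d)); apply: truncnS_gt.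
have N0 : 0 < N.+1%:R :> R by [].
(* N.+2 values per coordinate: the last one serves the coordinates equal to 1. *)
pose Q (g : {ffun 'I_k -> 'I_N.+2}) : set 'rV[R]_k :=
  [set x | forall i, (g i)%:R <= N.+1%:R * x 0 i <= (g i)%:R + 1].
have dQ g : (diam (Q g) <= (k%:R / N.+1%:R)%:E)%E.
  apply: diam_le => x y Qx Qy; rewrite lee_fin.
  rewrite -(@ler_sqr R) ?nnegrE ?enorm_ge0 ?divr_ge0 // enorm_sqr.
  apply: (@le_trans _ _ (\sum_(i < k) N.+1%:R^-1 ^+ 2)).
    apply: ler_sum => i _; rewrite !mxE.
    have /andP[h1 h2] := Qx i; have /andP[h3 h4] := Qy i.
    rewrite -real_normK ?num_real // lerXn2r ?nnegrE //.
    rewrite ler_norml -div1r lerNl ler_pdivlMr // ler_pdivlMr //.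
    rewrite opprB !mulrBl ![_ * N.+1%:R]mulrC; lra.
  rewrite sumr_const card_ord -[_ *+ k]mulr_natl exprMn.
  apply: ler_wpM2r; first exact: sqr_ge0.
  by case: (k) => [|k']; rewrite ?expr0n // expr2 ler_peMr // ler1n.
have cov : unit_cube R k `<=` \big[setU/set0]_(g : {ffun 'I_k -> 'I_N.+2}) Q g.
  move=> x cx; pose g := [ffun i => inord (Num.truncn (N.+1%:R * x 0 i)) : 'I_N.+2].
  have : Q g x.
    move=> i; rewrite /g ffunE; have /andP[x0 x1] := cx i.
    have /truncn_itv/andP[h1 h2] : 0 <= N.+1%:R * x 0 i by rewrite mulr_ge0.
    rewrite inordK.
      by rewrite h1 natr1 ltW.
    rewrite ltnS -(ler_nat R); apply: (le_trans h1).
    by rewrite ler_piMr.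
  move=> Qx; rewrite (bigD1 g) //=; by left.
apply: (le_trans (le_hausdorff_premeasure _ _ cov)).
apply: (le_trans (hausdorff_premeasure_bigcup _ _ _ _)).
apply: (@le_trans _ _ (\sum_(g : {ffun 'I_k -> 'I_N.+2})
    ((k%:R / N.+1%:R) ^+ k)%:E)%E).
  apply: lee_sum => g _.
  apply: (le_trans (hausdorff_premeasure_le_gauge _ _)).
    apply: (le_trans (dQ g)); rewrite lee_fin ler_pdivrMr // mulrC -ler_pdivrMr //.
    exact: ltW.
  rewrite /diam_gauge; case: asboolP => [_|/eqP/set0P Q0].
    by rewrite lee_fin exprn_ge0 // divr_ge0.
  by rewrite EFin_expe; apply: lee_expe => //; exact: diam_ge0.
rewrite sumEFin lee_fin sumr_const card_ffun !card_ord -[_ *+ _]mulr_natl natrX -exprMn.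
apply: lerXn2r; rewrite ?nnegrE ?mulr_ge0 ?divr_ge0 //.
rewrite mulrA ler_pdivrMr // -mulrA [_ * k%:R]mulrC mulrCA ler_wpM2l //.
rewrite -natrM ler_nat; lia.
Qed.

(** A lower bound for the Lebesgue outer measure of the cube, by induction on
the dimension: for each t in [0,1], the cubes of the cover that meet the
hyperplane at height t cut it in a cover of a unit cube of dimension one less;
integrating the resulting inequality over t gives the claim.  The flag [act]
selects the cubes that meet the slice without renumbering the family. *)
Lemma cube_cover_volume_ge1 (R : realType) (k : nat) (act : nat -> bool)
    (a : nat -> 'rV[R]_k) (s : nat -> R) : (forall j, 0 <= s j) ->
  (forall x, unit_cube R k x -> exists2 j, act j &
    forall i, a j 0 i <= x 0 i <= a j 0 i + s j) ->
  (1 <= \sum_(0 <= j <oo) (if act j then (s j ^+ k)%:E else 0))%E.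
Proof.
move=> s0; elim: k => [|k IH] in act a *.
  move=> /(_ 0) [|j actj _]; first by case.
  apply: (@le_trans _ _ (\sum_(0 <= i < j.+1) if act i then (s i ^+ 0)%:E else 0)%E).
    rewrite big_nat_recr //= actj expr0 leeDr // sume_ge0 // => i _.
    by case: ifP; rewrite ?lee_fin.
  by apply: nneseries_lim_ge => i _ _; case: ifP; rewrite ?lee_fin ?exprn_ge0.
move=> cov.
pose b j := a j 0 0.
pose I j : set R := [set` `[b j, b j + s j]].
pose c j : R := if act j then s j ^+ k else 0.
have c0 j : 0 <= c j by rewrite /c; case: ifP => // _; exact: exprn_ge0.
have slice (t : R) : `[0, 1]%classic t ->
    (1 <= \sum_(0 <= j <oo) (c j)%:E * (\1_(I j) t)%:E)%E.
  move=> /= t01.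
  apply: le_trans (IH (fun j => act j && (t \in I j))
    (fun j => @rsubmx R 1 1 k (a j)) _) _ => [x cx|].
    pose y : 'rV[R]_k.+1 := row_mx (t%:M : 'rV_1) x.
    have y0 : y 0 0 = t.
      have -> : 0 = lshift k (0 : 'I_1) by exact/val_inj.
      by rewrite /y (row_mxEl (t%:M : 'rV_1) x 0 0) mxE eqxx.
    have yS i : y 0 (rshift 1 i) = x 0 i by exact: row_mxEr.
    have [|j actj jx] := cov y.
      move=> i; case: (@split_ordP 1 k i) => i' ->; last by rewrite yS.
      have -> : lshift k i' = 0 by apply/val_inj; rewrite /= ord1.
      by rewrite y0; move: t01; rewrite in_itv.
    exists j; last by move=> i; have := jx (rshift 1 i); rewrite yS mxE.
    by rewrite actj; apply/mem_set; rewrite /I /= in_itv /= -y0; exact: jx.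
  apply: lee_nneseries => [j _ _|j _].
    by case: ifP; rewrite ?lee_fin ?exprn_ge0.
  rewrite -EFinM indicE /c; case: (act j) => /=; last by rewrite mul0r.
  by case: (t \in I j); rewrite ?mulr1 ?mulr0.
have mD : measurable (`[0, 1]%classic : set R) by exact: measurable_itv.
have mI j : measurable (I j) by exact: measurable_itv.
have mcI j : measurable_fun (`[0, 1]%classic : set R) (fun t : R => (c j)%:E * (\1_(I j) t)%:E)%E.
  apply: measurable_funeM; apply/measurable_EFinP; exact: measurable_indic.
have -> : (1 = \int[lebesgue_measure]_(t in (`[0%R, 1%R]%classic : set R)) (1 : R)%:E :> \bar R)%E.
  rewrite integral_cst //= mul1e lebesgue_measure_itv /= lte_fin ltr01.
  by rewrite oppr0 addr0.
apply: (@le_trans _ _ (\int[lebesgue_measure]_(t in (`[0%R, 1%R]%classic : set R))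
   \sum_(0 <= j <oo) (c j)%:E * (\1_(I j) t)%:E)%E).
  apply: ge0_le_integral => //.
  - apply: ge0_emeasurable_sum => [j t _ _|j _]; last exact: mcI.
    by rewrite -EFinM lee_fin mulr_ge0.
rewrite integral_nneseries //; last first.
  by move=> j t _; rewrite -EFinM lee_fin mulr_ge0.
apply: lee_nneseries => [j _ _|j _].
  by apply: integral_ge0 => t _; rewrite -EFinM lee_fin mulr_ge0.
rewrite ge0_integralZl_EFin //; last first.
  by apply/measurable_EFinP; apply: measurable_indic; exact: mI.
rewrite integral_indic; [|exact: mD|exact: mI].
apply: (@le_trans _ _ ((c j)%:E * (s j)%:E)%E).
  apply: lee_wpmul2l; first by rewrite lee_fin.
  apply: (@le_trans _ _ (lebesgue_measure (I j))).
    apply: le_measure; last exact: subIsetl.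
      by apply/mem_set; exact: measurableI _ _ (mI j) mD.
    by apply/mem_set; exact: mI.
  rewrite lebesgue_measure_itv /=; case: ifP => _; last by rewrite lee_fin.
  by rewrite -EFinD addrAC subrr add0r.
rewrite /c -EFinM; case: (act j); last by rewrite mul0r.
by rewrite exprSr.
Qed.

(** A set of diameter d lies in a cube of side 2 d, so the cube volumes of
[cube_cover_volume_ge1] bound 2^k times the sum of the gauges from below. *)
Lemma hausdorff_measure_unit_cube_gt0 (R : realType) (k : nat) :
  (0 < hausdorff_measure k (unit_cube R k))%E.
Proof.
apply: (@lt_le_trans _ _ ((2 ^+ k)^-1)%:E); first by rewrite lte_fin invr_gt0 exprn_gt0.
apply: le_trans (hausdorff_premeasure_le_measure _ _ ltr01).
apply/ereal_infP => _ [E [cov dE] <-].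
(* An empty set of the cover has no centre and contributes nothing. *)
pose act j := `[< E j !=set0 >].
pose d j := fine (diam (E j)).
have dP j : E j !=set0 -> diam (E j) = (d j)%:E /\ 0 <= d j.
  move=> E0; have := diam_ge0 E0; have := dE j; rewrite /d.
  by case: (diam (E j)).
pose a j : 'rV[R]_k := get (E j) - const_mx (d j).
pose s j := 2 * Num.max 0 (d j).
have s0 j : 0 <= s j by rewrite mulr_ge0 // le_max lexx.
have H : (1 <= \sum_(0 <= j <oo) (if act j then (s j ^+ k)%:E else 0))%E.
  apply: (cube_cover_volume_ge1 (a := a)) => // x cx.
  have [j _ Ejx] := cov _ cx; exists j; first by apply/asboolP; exists x.
  have E0 : E j !=set0 by exists x.
  have [dj dj0] := dP j E0.
  have Eg : E j (get (E j)) by exact: getPex.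
  move=> i; rewrite /a /s !mxE max_r //.
  have := enorm_le_diam Ejx Eg; rewrite dj lee_fin.
  move/(le_trans (coord_le_enorm _ i)); rewrite !mxE ler_norml => /andP[h1 h2].
  by apply/andP; split; lra.
rewrite -[X in (X <= _)%E]mul1e muleC -[(_ * _)%E]mule1.
apply: (@le_trans _ _ ((2 ^+ k)^-1%:E * ((2 ^+ k)%:E *
    \sum_(0 <= j <oo) diam_gauge k (E j)))%E); last first.
  by rewrite muleA -EFinM mulVf ?mul1e // gt_eqF ?exprn_gt0.
rewrite mule1; apply: lee_wpmul2l; first by rewrite lee_fin invr_ge0 exprn_ge0.
rewrite -nneseriesZl; last by move=> *; exact: diam_gauge_ge0.
apply: (le_trans H); apply: lee_nneseries => [j _ _|j _].
  by case: ifP; rewrite ?lee_fin ?exprn_ge0.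
rewrite /act; case: asboolP => E0; last first.
  by apply: mule_ge0; [rewrite lee_fin exprn_ge0 | exact: diam_gauge_ge0].
rewrite /diam_gauge; case: asboolP => [/eqP|_]; first by move/set0P: E0 => /negP.
have [-> dj0] := dP j E0.
by rewrite -EFin_expe -EFinM lee_fin /s max_r // exprMn.
Qed.

(** The recursion is the integration by parts that reduces cos^(m+2) to cos^m,
so that the recursion of [wallis] holds by evaluation at the end points. *)
(** * Integrals of powers of the cosine *)

Fixpoint cos_primitive (R : realType) (m : nat) (t : R) : R :=
  match m with
  | 0 => t
  | 1 => sin t
  | m'.+2 =>
      (cos t ^+ m'.+1 * sin t + m'.+1%:R * cos_primitive m' t) / m'.+2%:R
  end.

Lemma is_derive_cos_primitive (R : realType) (m : nat) (t : R) :
  is_derive t 1 (@cos_primitive R m) (cos t ^+ m).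
Proof.
suff [] : is_derive t 1 (@cos_primitive R m) (cos t ^+ m) /\
          is_derive t 1 (@cos_primitive R m.+1) (cos t ^+ m.+1) by [].
elim: m => [|m [IH1 IH2]].
  split; first by rewrite expr0; exact: is_derive_id.
  by rewrite expr1; exact: is_derive_sin.
split=> //.
have H : is_derive t 1 ((m.+2%:R : R)^-1 \*: ((@cos R ^+ m.+1) * (@sin R) +
   (m.+1%:R : R) \*: (@cos_primitive R m))) (cos t ^+ m.+2).
  apply: is_derive_eq.
  transitivity ((m.+1%:R + 1)^-1 * (cos t ^+ m.+1 * cos t +
    sin t * (m.+1%:R * cos t ^+ m * - sin t) + m.+1%:R * cos t ^+ m)).
    by rewrite /GRing.scale /= !fctE natr1.
  have s2 : sin t ^+ 2 = 1 - cos t ^+ 2 by rewrite -(cos2Dsin2 t) addrC addKr.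
  have -> : sin t * (m.+1%:R * cos t ^+ m * - sin t) =
    - (sin t ^+ 2) * cos t ^+ m * m.+1%:R by ring.
  have m2 : m.+1%:R + 1 != 0 :> R by rewrite natr1.
  rewrite s2 (exprS _ m.+1) (exprS _ m).
  by field; rewrite gt_eqF //; have := ler0n R m; lra.
suff -> : cos_primitive m.+2 = (m.+2%:R : R)^-1 \*: ((@cos R ^+ m.+1) * (@sin R) +
   (m.+1%:R : R) \*: (@cos_primitive R m)) by exact: H.
by apply/funext => x; rewrite /= mulrC !fctE.
Qed.

Lemma continuous_cos_primitive (R : realType) (m : nat) :
  continuous (@cos_primitive R m).
Proof.
move=> t; apply: differentiable_continuous; apply/derivable1_diffP.
by have [] := is_derive_cos_primitive m t.
Qed.

(** The integral of cos^m over [-pi/2, pi/2]. *)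
Definition wallis (R : realType) (m : nat) : R :=
  cos_primitive m (pi / 2) - cos_primitive m (- (pi / 2)).
Arguments wallis R m : clear implicits.

Lemma wallis0 (R : realType) : wallis R 0 = pi.
Proof. by rewrite /wallis /= opprK -splitr. Qed.

Lemma wallis1 (R : realType) : wallis R 1 = 2.
Proof. by rewrite /wallis /= sinN sin_pihalf opprK. Qed.

Lemma wallisSS (R : realType) (m : nat) :
  wallis R m.+2 = m.+1%:R / m.+2%:R * wallis R m.
Proof.
rewrite /wallis /= cosN cos_pihalf !expr0n /= !mul0r !add0r.
by rewrite mulrBr ![_ / _ * _]mulrAC.
Qed.

Lemma wallis_gt0 (R : realType) (m : nat) : 0 < wallis R m.
Proof.
suff [] : 0 < wallis R m /\ 0 < wallis R m.+1 by [].
elim: m => [|m [IH1 IH2]]; first by rewrite wallis0 wallis1 pi_gt0.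
by split=> //; rewrite wallisSS mulr_gt0 // divr_gt0.
Qed.

Lemma cos_primitive_mean_value (R : realType) (m : nat) (a b : R) : a <= b ->
  exists2 xi, a <= xi <= b &
    cos_primitive m b - cos_primitive m a = cos xi ^+ m * (b - a).
Proof.
move=> ab.
have [||xi] := @MVT_segment R (@cos_primitive R m) (fun t => cos t ^+ m) a b ab.
- by move=> x _; exact: is_derive_cos_primitive.
- by apply: continuous_subspaceT; exact: continuous_cos_primitive.
by rewrite in_itv /= => h1 h2; exists xi.
Qed.

(* polynomial *)
(** * The magnitude numerator *)

Lemma magnitude_numeratorSS (R : realType) (n : nat) :
  magnitude_numerator R n.+2 =
  magnitude_numerator R n * ((n.+1%:R^-1 *: 'X) ^+ 2 + 1).
Proof.
rewrite /magnitude_numerator /= negbK.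
have [|n0] := boolP (n == 0%N).
  move/eqP ->; rewrite /= big_mkcond big_nat1 /=.
  by rewrite (@big_geq _ _ _ 1 0) // -scalerAl mul1r.
rewrite -lt0n in n0.
case: ifP => n_odd; rewrite big_mkcond /= (@big_nat_recr _ _ _ n.+1) //=.
  by rewrite n_odd /= (@big_nat_recr _ _ _ n) //= n_odd /= mulr1 -big_mkcond mulrA.
rewrite n_odd /= (@big_nat_recr _ _ _ n) //= n_odd /= mulr1 -big_mkcond.
by rewrite -scalerAl.
Qed.

Lemma quadratic_factor (R : realType) (n : nat) :
  size ((n.+1%:R^-1 *: 'X) ^+ 2 + 1 : {poly R}) = 3 /\
  lead_coef ((n.+1%:R^-1 *: 'X) ^+ 2 + 1 : {poly R}) = n.+1%:R^-1 ^+ 2.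
Proof.
have n0 : n.+1%:R^-1 ^+ 2 != 0 :> R by rewrite expf_neq0 // invr_eq0.
rewrite exprZn.
have sz : size (n.+1%:R^-1 ^+ 2 *: 'X ^+ 2 : {poly R}) = 3.
  by rewrite size_scale // size_polyXn.
split; first by rewrite size_polyDl sz // size_poly1.
by rewrite lead_coefDl ?sz ?size_poly1 // lead_coefZ lead_coefXn mulr1.
Qed.

(** Both sides of the second equation get divided by (n+1)^2 when [n] increases
by two, by [magnitude_numeratorSS] and [wallisSS]. *)
Lemma magnitude_numerator_lead (R : realType) (n : nat) :
  size (magnitude_numerator R n) = n.+1 /\
  lead_coef (magnitude_numerator R n) = 2 * pi / (n`!%:R * wallis R n).
Proof.
have pi0 : pi != 0 :> R by rewrite gt_eqF ?pi_gt0.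
pose P n := size (magnitude_numerator R n) = n.+1 /\
  lead_coef (magnitude_numerator R n) = 2 * pi / (n`!%:R * wallis R n).
suff [] : P n /\ P n.+1 by [].
elim: n => [|n [IH1 IH2]].
  rewrite /P /magnitude_numerator /= !big_geq // wallis0 wallis1 fact0 mul1r.
  split; split.
  - by rewrite size_scale ?size_poly1 // pnatr_eq0.
  - by rewrite lead_coefZ lead_coef1 mulr1 mulfK.
  - by rewrite mulr1 size_scale // size_polyX.
  - by rewrite mulr1 lead_coefZ lead_coefX mulr1 mul1r mulrAC mulfV ?mul1r // pnatr_eq0.
split=> //; rewrite /P magnitude_numeratorSS.
have [sq lq] := quadratic_factor R n; case: IH1 => sn ln.
split.
  rewrite size_mul ?sn ?sq ?addn3 // -size_poly_gt0 ?sn ?sq //.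
rewrite lead_coefM ln lq wallisSS !factS !natrM.
have w0 : wallis R n != 0 by rewrite gt_eqF ?wallis_gt0.
have f0 : n`!%:R != 0 :> R by rewrite pnatr_eq0 -lt0n fact_gt0.
by field; rewrite f0 w0 nat1r -natrD !pnatr_eq0.
Qed.

Lemma leading_term_magnitude_numerator (R : realType) (n : nat) :
  leading_term (magnitude_numerator R n) =
  (2 * pi / (n`!%:R * wallis R n)) *: 'X^n.
Proof.
by have [s l] := magnitude_numerator_lead R n; rewrite /leading_term s l.
Qed.

Lemma magnitude_numerator_coef0 (R : realType) (n : nat) :
  (magnitude_numerator R n)`_0 = (1 + (-1) ^+ n)%:~R.
Proof.
rewrite -horner_coef0.
suff [] : (magnitude_numerator R n).[0] = (1 + (-1) ^+ n)%:~R /\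
  (magnitude_numerator R n.+1).[0] = (1 + (-1) ^+ n.+1)%:~R by [].
elim: n => [|n [IH1 IH2]].
  rewrite /magnitude_numerator /= !big_geq // !hornerE /= expr1 addrN.
  by rewrite ?mulr1 ?mulr0 ?scaler0.
split=> //; rewrite magnitude_numeratorSS hornerM IH1 !hornerE.
by rewrite expr0n add0r mulr1 !exprS mulrA mulrNN !mul1r.
Qed.

(** The primitive comes from the substitution u = r sin theta, under which
sqrt (r^2 - u^2)^m du becomes r^(m+1) (cos theta)^(m+1) d theta. *)
(** * The volume of the ball *)

Lemma is_derive_circle_primitive (R : realType) (m : nat) (r t : R) :
  0 < r -> -r < t < r ->
  is_derive t 1 (fun u => r ^+ m.+1 * cos_primitive m.+1 (asin (u / r)))
    (Num.sqrt (r ^+ 2 - t ^+ 2) ^+ m).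
Proof.
move=> r0 /andP[rt tr].
have rN0 : r != 0 by rewrite gt_eqF.
have u1 : -1 < t / r < 1.
  by rewrite ltr_pdivlMr // ltr_pdivrMr // mulN1r mul1r rt tr.
have d1 : is_derive t 1 (fun u : R => u / r) r^-1.
  have H : is_derive t 1 (r^-1 \*: @idfun R) r^-1.
    by apply: is_derive_eq; rewrite /GRing.scale /= mulr1.
  suff -> : (fun u : R => u / r) = r^-1 \*: @idfun R by [].
  by apply/funext => u; rewrite /= mulrC.
have d2 := is_derive1_asin u1.
have d3 := @is_derive1_comp _ (@asin R) (fun u => u / r) t _ _ d2 d1.
have d4 := @is_derive1_comp _ _ (@asin R \o (fun u => u / r)) t _ _
  (is_derive_cos_primitive m.+1 (asin (t / r))) d3.
have H : is_derive t 1 (r ^+ m.+1 \*: (cos_primitive m.+1 \o (@asin R \o (fun u : R => u / r))))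
    (r ^+ m.+1 * (cos (asin (t / r)) ^+ m.+1 * ((Num.sqrt (1 - (t / r) ^+ 2))^-1 * r^-1))).
  exact: is_deriveZ.
suff -> : Num.sqrt (r ^+ 2 - t ^+ 2) ^+ m =
  r ^+ m.+1 * (cos (asin (t / r)) ^+ m.+1 * ((Num.sqrt (1 - (t / r) ^+ 2))^-1 * r^-1)).
  exact: H.
have u1' : -1 <= t / r <= 1 by case/andP: u1 => *; rewrite !ltW.
rewrite cos_asin //; set w := Num.sqrt (1 - _).
have sE : Num.sqrt (r ^+ 2 - t ^+ 2) = r * w.
  rewrite -[r in RHS](ger0_norm (ltW r0)) -sqrtr_sqr -sqrtrM ?sqr_ge0 //.
  by congr Num.sqrt; field.
have w0 : w != 0.
  rewrite gt_eqF // sqrtr_gt0 subr_gt0 -[ltRHS](expr1n _ 2).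
  by rewrite -real_normK ?num_real // ltr_sqr ?nnegrE // ltr_norml.
rewrite sE exprMn !exprS.
by field; rewrite w0 rN0.
Qed.

(** The derivative of the arcsine blows up at the end points, so that continuity
there is obtained from that of the inverse function r sin. *)
Lemma continuous_circle_primitive (R : realType) (m : nat) (r c : R) :
  0 < r ->
  {within `[- r, r], continuous
    (fun u => c * cos_primitive m.+1 (asin (u / r)))}.
Proof.
move=> r0.
have ca : {within `[- r, r], continuous (fun u => asin (u / r))}.
  have := @segment_can_le_continuous _ (- (pi / 2)) (pi / 2)
    (fun t => r * sin t) (fun u => asin (u / r)).
  rewrite /= sinN sin_pihalf mulrN1 mulr1; apply.
  - by have := pi_gt0 R; lra.
  - apply: continuous_subspaceT => t; apply: continuousM; first exact: cst_continuous.
    exact: continuous_sin.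
  - move=> t tpi; rewrite mulrAC mulfV ?gt_eqF // mul1r; exact: sinK.
move=> t; apply: (@continuous_comp _ _ _ _
  (fun y => c * cos_primitive m.+1 y) t (ca t)).
apply: continuousM; first exact: cst_continuous.
exact: continuous_cos_primitive.
Qed.

Lemma integral_circle (R : realType) (m : nat) (r c : R) : 0 <= r ->
  (\int[lebesgue_measure]_(t in (`[(- r)%R, r]%classic : set R))
     (c * Num.sqrt (r ^+ 2 - t ^+ 2) ^+ m)%:E)%E =
  (c * (r ^+ m.+1 * wallis R m.+1))%:E.
Proof.
rewrite le_eqVlt => /orP[/eqP <-|r0].
  by rewrite oppr0 set_itv1 integral_set1 expr0n mul0r mulr0.
have F0 : - r < r by rewrite gtrN.
have rN0 : r != 0 by rewrite gt_eqF.
pose F t := c * r ^+ m.+1 * cos_primitive m.+1 (asin (t / r)).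
have cF : {within `[- r, r], continuous F}.
  exact: continuous_circle_primitive.
have dF t : -r < t < r -> is_derive t 1 F (c * Num.sqrt (r ^+ 2 - t ^+ 2) ^+ m).
  move=> tr; have := is_derive_circle_primitive m r0 tr => H.
  suff -> : F = c \*: (fun u => r ^+ m.+1 * cos_primitive m.+1 (asin (u / r))).
    exact: is_deriveZ.
  by apply/funext => u; rewrite /F /= -mulrA.
have cf : continuous (fun t : R => c * Num.sqrt (r ^+ 2 - t ^+ 2) ^+ m).
  move=> t.
  have H0 : {for t, continuous (fun t : R => r ^+ 2 - t ^+ 2)}.
    by apply: (continuousB (@cst_continuous _ _ (r ^+ 2) t)); exact: exprn_continuous.
  have H1 : {for t, continuous (fun t : R => Num.sqrt (r ^+ 2 - t ^+ 2))}.
    apply: (continuous_comp H0); exact: sqrt_continuous.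
  have H2 : {for t, continuous (fun t : R => Num.sqrt (r ^+ 2 - t ^+ 2) ^+ m)}.
    exact: (continuous_comp H1 (@exprn_continuous _ m _)).
  exact: (continuousM (@cst_continuous _ _ c t) H2).
rewrite (@continuous_FTC2 _ _ F) //.
- rewrite -EFinB /F -mulrBr mulNr mulfV // mulrA; congr (_ * _)%:E.
  have pi0 := pi_ge0 R.
  have -> : asin 1 = pi / 2 :> R.
    have := @sinK R (pi / 2); rewrite sin_pihalf; apply.
    by rewrite in_itv /= lexx andbT; lra.
  have -> : asin (-1) = - (pi / 2) :> R.
    have := @sinK R (- (pi / 2)); rewrite sinN sin_pihalf; apply.
    by rewrite in_itv /= lexx /=; lra.
  by [].
- by apply: continuous_subspaceT; exact: cf.
- have [_ h1 h2] := (continuous_within_itvP F F0).1 cF.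
  split=> // t; rewrite in_itv /= => /dF; by case.
- by move=> t; rewrite in_itv /= => /dF [? ?]; rewrite derive1E.
Qed.

Lemma lebesgue_vol_set0 (R : realType) (k : nat) :
  lebesgue_vol (set0 : set 'rV[R]_k) = 0%E.
Proof.
elim: k => [|k IH] /=; first by rewrite indic0.
by apply: integral0_eq => t _; exact: IH.
Qed.

(** The value of omega_k obtained by slicing. *)
Definition ball_const (R : realType) (k : nat) : R := \prod_(i < k) wallis R i.+1.
Arguments ball_const R k : clear implicits.

Lemma lebesgue_vol_ball (R : realType) (k : nat) (r : R) : 0 <= r ->
  lebesgue_vol [set x : 'rV[R]_k | enorm x <= r] = (ball_const R k * r ^+ k)%:E.
Proof.
elim: k r => [|k IH] r r0.
  rewrite /= /ball_const big_ord0 mul1r expr0 indicE mem_set //=.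
  by rewrite enorm0.
rewrite /=.
transitivity (\int[lebesgue_measure]_(t in (`[(- r)%R, r]%classic : set R))
     (ball_const R k * Num.sqrt (r ^+ 2 - t ^+ 2) ^+ k)%:E)%E; last first.
  by rewrite integral_circle // /ball_const big_ord_recr /= mulrA mulrAC.
rewrite [RHS]integral_mkcond; apply: eq_integral => t _.
rewrite patchE; case: ifPn => [|] tr.
  have r2 : t ^+ 2 <= r ^+ 2.
    rewrite -real_normK ?num_real // ler_sqr ?nnegrE // ler_norml.
    by move: tr; rewrite inE /= in_itv.
  rewrite -IH ?sqrtr_ge0 //; congr lebesgue_vol; apply/funext => x /=; apply/propext.
  suff E : (enorm (row_mx (t%:M : 'rV_1) x) <= r) =
      (enorm x <= Num.sqrt (r ^+ 2 - t ^+ 2)) by rewrite -E.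
  rewrite -(ler_sqr (enorm_ge0 (row_mx _ x)) r0).
  rewrite -(ler_sqr (enorm_ge0 x) (sqrtr_ge0 _)).
  rewrite enorm_row_mx_sqr enorm_scalar_sqr.
  by rewrite (@sqr_sqrtr _ (r ^+ 2 - _)) ?subr_ge0 // lerBrDl.
transitivity (lebesgue_vol (set0 : set 'rV[R]_k)); last exact: lebesgue_vol_set0.
congr lebesgue_vol; apply/seteqP; split=> // x /= h.
move/negP: tr; apply; rewrite inE /= in_itv /= -ler_norml.
apply: le_trans h; rewrite -(@ler_sqr R) ?nnegrE ?enorm_ge0 //.
by rewrite (@enorm_row_mx_sqr R 1 k) enorm_scalar_sqr real_normK ?num_real // lerDl sqr_ge0.
Qed.

Lemma ball_volumeE (R : realType) (n : nat) : ball_volume R n = ball_const R n.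
Proof.
by rewrite /ball_volume /closed_unit_ball lebesgue_vol_ball //= expr1n mulr1.
Qed.

(** * Trigonometric estimates *)

Lemma cos_lipschitz (R : realType) (a b : R) : `|cos a - cos b| <= `|a - b|.
Proof.
wlog ab : a b / b <= a.
  by move=> H; have [/H //|/ltW/H] := leP b a; rewrite distrC [leRHS]distrC.
have [|c _ ->] := @MVT_segment R (@cos R) (fun x => - sin x) b a ab _.
  by apply: continuous_subspaceT; exact: continuous_cos.
by rewrite normrM normrN ler_piMl // sin_max.
Qed.

Lemma sin_mean_value (R : realType) (h : R) :
  exists2 xi, `|xi| <= `|h| & sin h = cos xi * h.
Proof.
wlog h0 : h / 0 <= h.
  move=> H; have [/H //|h0] := leP 0 h.
  have [|xi x1 x2] := H (- h); first by lra.
  exists xi; first by rewrite -[leRHS]normrN.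
  by move: x2; rewrite sinN mulrN => /oppr_inj.
have [xi /andP[x1 x2]] := @cos_primitive_mean_value R 1 0 h h0.
rewrite /= sin0 !subr0 expr1 => x3; exists xi => //.
by rewrite !ger0_norm.
Qed.

(** The left-hand side is the squared distance of two points of the unit circle
at angle s - t, that is (2 sin ((s - t) / 2))^2. *)
Lemma chord_mean_value (R : realType) (s t : R) : exists2 xi, `|xi| <= `|s - t| &
  (sin s - sin t) ^+ 2 + (cos s - cos t) ^+ 2 = (cos xi * (s - t)) ^+ 2.
Proof.
have [xi x1 x2] := sin_mean_value ((s - t) / 2); exists xi.
  apply: (le_trans x1); rewrite normrM (@ger0_norm _ 2^-1) ?invr_ge0 //.
  by have := normr_ge0 (s - t); lra.
have -> : cos xi * (s - t) = 2 * sin ((s - t) / 2) by rewrite x2; field.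
have h2 : s - t = ((s - t) / 2) *+ 2 by rewrite mulr2n -splitr.
have := cosB s t; rewrite {1}h2 cos_mulr2n cos2sin2.
have := cos2Dsin2 s; have := cos2Dsin2 t; rewrite mulr2n.
by move: (sin s) (cos s) (sin t) (cos t) (sin _) => *; nra.
Qed.

Lemma chord_le (R : realType) (s t : R) :
  (sin s - sin t) ^+ 2 + (cos s - cos t) ^+ 2 <= (s - t) ^+ 2.
Proof.
have [xi _ ->] := chord_mean_value s t.
by rewrite exprMn ler_piMl ?sqr_ge0 // cos2sin2 gerBl sqr_ge0.
Qed.

Lemma chord_ge (R : realType) (s t h : R) : `|s - t| <= h -> h <= 1 ->
  ((1 - h) * (s - t)) ^+ 2 <= (sin s - sin t) ^+ 2 + (cos s - cos t) ^+ 2.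
Proof.
move=> sth h1; have [xi xs ->] := chord_mean_value s t.
rewrite !exprMn ler_wpM2r ?sqr_ge0 // lerXn2r ?nnegrE ?subr_ge0 //.
  have := cos_lipschitz 0 xi; rewrite cos0 sub0r normrN ler_norml => /andP[_].
  have := le_trans xs sth; have := normr_ge0 xi; lra.
have := cos_lipschitz 0 xi; rewrite cos0 sub0r normrN ler_norml => /andP[_].
have := le_trans xs sth; have := normr_ge0 xi; lra.
Qed.

(** The error made on (cos xi)^n when cos xi is replaced by an upper bound of the
cosine over a band of width [d]. *)
Lemma exprD_le (R : realType) (n : nat) (c d e : R) :
  0 <= c <= 1 -> 0 <= d <= e -> (c + d) ^+ n <= c ^+ n + n%:R * (1 + e) ^+ n * d.
Proof.
move=> /andP[c0 c1] /andP[d0 de]; elim: n => [|n IH].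
  by rewrite !expr0 !mul0r addr0.
have e0 : 0 <= e by lra.
have cn : c ^+ n <= 1 by rewrite exprn_ile1.
have cn0 : 0 <= c ^+ n by rewrite exprn_ge0.
have E1 : 1 <= (1 + e) ^+ n by rewrite exprn_ege1 // lerDl.
rewrite !exprS -natr1.
apply: (le_trans (ler_wpM2l (addr_ge0 c0 d0) IH)).
move: cn cn0 E1; move: (c ^+ n) ((1 + e) ^+ n) => x y x1 x0 y1.
have n0 := ler0n R n; move: n0; move: (n%:R : R) => q q0.
rewrite -subr_ge0.
have -> : c * x + (q + 1) * ((1 + e) * y) * d - (c + d) * (x + q * y * d) =
  q * y * d * ((1 - c) + (e - d)) + d * (y - x + e * y) by ring.
by apply: addr_ge0; rewrite !mulr_ge0 //; try lra; rewrite addr_ge0 ?mulr_ge0; lra.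
Qed.

(** * Riemann sums of interval functions *)

Lemma le_of_le_add_invn (R : realType) (x K : R) (y : \bar R) :
  (forall N, (y <= (x + K / N.+1%:R)%:E)%E) -> (y <= x%:E)%E.
Proof.
move=> H; apply/lee_addgt0Pr => e e0.
have [N KN] : exists N, K / e < N.+1%:R.
  by exists (Num.truncn (K / e)); apply: truncnS_gt.
apply: (le_trans (H N)); rewrite -EFinD lee_fin lerD2l ler_pdivrMr // mulrC.
by rewrite -ler_pdivrMr // ltW.
Qed.

Lemma le_of_sub_invn_le (R : realType) (x K : R) (y : \bar R) :
  (forall N, ((x - K / N.+1%:R)%:E <= y)%E) -> (x%:E <= y)%E.
Proof.
move=> H; apply/lee_addgt0Pr => e e0.
have [N KN] : exists N, K / e < N.+1%:R.
  by exists (Num.truncn (K / e)); apply: truncnS_gt.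
apply: (@le_trans _ _ ((x - K / N.+1%:R)%:E + e%:E)%E); last exact: leeD.
rewrite -EFinD lee_fin -addrA lerDl addrC subr_ge0 ler_pdivrMr // mulrC.
by rewrite -ler_pdivrMr // ltW.
Qed.

(** If an interval function is subadditive and bounded on small intervals by the
increment of [g] up to a quadratic error, then cutting [A, B] into N + 1 equal
parts leaves a total error of order 1 / (N + 1). *)
Lemma interval_upper_bound (R : realType) (beta : R -> R -> \bar R) (g : R -> R)
    (A B C k : R) : A < B ->
  (forall a b c : R, A <= a -> a < b -> b < c -> c <= B ->
    (beta a c <= beta a b + beta b c)%E) ->
  (forall a b : R, A <= a -> a < b -> b <= B ->
    (beta a b <= (k * (g b - g a + C * (b - a) ^+ 2))%:E)%E) ->
  (beta A B <= (k * (g B - g A))%:E)%E.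
Proof.
move=> AB sub loc; apply: (@le_of_le_add_invn _ _ (k * C * (B - A) ^+ 2)) => N.
pose d := (B - A) / N.+1%:R.
have N0 : 0 < N.+1%:R :> R by [].
have d0 : 0 < d by rewrite divr_gt0 // subr_gt0.
have Nd : N.+1%:R * d = B - A by rewrite /d mulrC divfK // gt_eqF.
have key i : (i <= N)%N -> (beta A (A + i.+1%:R * d)%R <=
    (k * (g (A + i.+1%:R * d) - g A + C * (i.+1%:R * d ^+ 2)))%:E)%E.
  elim: i => [|i IH] iN.
    rewrite !mul1r.
    have -> : d ^+ 2 = ((A + d) - A) ^+ 2 by rewrite addrAC subrr add0r.
    apply: loc => //; first by lra.
    have : 1 * d <= N.+1%:R * d by rewrite ler_wpM2r ?ler1n // ltW.
    by rewrite Nd; lra.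
  pose b := A + i.+1%:R * d; pose c := A + i.+2%:R * d.
  have bc : c = b + d by rewrite /c /b -[i.+2%:R]natr1 mulrDl mul1r addrA.
  have Ab : A < b by rewrite /b ltrDl mulr_gt0.
  have cB : c <= B.
    have : i.+2%:R * d <= N.+1%:R * d by rewrite ler_wpM2r ?ler_nat // ltW.
    by rewrite Nd /c; lra.
  have bltc : b < c by rewrite bc ltrDl.
  apply: (le_trans (sub A b c _ _ _ _)) => //.
  apply: (le_trans (leeD (IH (ltnW iN)) (loc b c _ bltc cB))); first exact: ltW.
  rewrite -/b -/c -EFinD lee_fin -mulrDr.
  have -> : (c - b) ^+ 2 = d ^+ 2 by rewrite bc addrAC subrr add0r.
  by rewrite -[i.+2%:R]natr1 le_eqVlt; apply/orP; left; apply/eqP; ring.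
have := key N (leqnn _); rewrite Nd addrC subrK => /le_trans; apply.
rewrite lee_fin le_eqVlt; apply/orP; left; apply/eqP.
by rewrite /d; field; rewrite nat1r gt_eqF.
Qed.

(** The counterpart of [interval_upper_bound] for a function that is superadditive
only over separated intervals: a gap, also of quadratic size, is left between
consecutive parts, and the Lipschitz bound on [g] controls what the gaps lose. *)
Lemma interval_lower_bound (R : realType) (beta : R -> R -> \bar R) (g : R -> R)
    (A B C k : R) : A < B -> 0 <= k -> 0 <= C ->
  (forall a b : R, a < b -> g b - g a <= b - a) ->
  (forall a b b' c : R, A <= a -> a < b -> b < b' -> b' < c -> c <= B ->
    (beta a b + beta b' c <= beta a c)%E) ->
  (forall a b : R, A <= a -> a < b -> b <= B ->
    ((k * (g b - g a - C * (b - a) ^+ 2))%:E <= beta a b)%E) ->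
  ((k * (g B - g A))%:E <= beta A B)%E.
Proof.
move=> AB k0 C0 glip sup loc.
apply: (@le_of_sub_invn_le _ _ (k * (C + 1) * (B - A) ^+ 2)) => N.
pose d := (B - A) / N.+1%:R.
have N0 : 0 < N.+1%:R :> R by [].
have d0 : 0 < d by rewrite divr_gt0 // subr_gt0.
have Nd : N.+1%:R * d = B - A by rewrite /d mulrC divfK // gt_eqF.
have key i : (i <= N)%N ->
    ((k * (g (A + i.+1%:R * d) - g A - (C + 1) * (i.+1%:R * d ^+ 2)))%:E <=
     beta A (A + i.+1%:R * d)%R)%E.
  elim: i => [|i IH] iN.
    rewrite !mul1r.
    apply: (@le_trans _ _ (k * (g (A + d) - g A - C * ((A + d) - A) ^+ 2))%:E).
      rewrite lee_fin ler_wpM2l // lerD2l lerN2 addrAC subrr add0r.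
      by rewrite ler_wpM2r ?sqr_ge0 // lerDl.
    apply: loc => //; first by lra.
    have : 1 * d <= N.+1%:R * d by rewrite ler_wpM2r ?ler1n // ltW.
    by rewrite Nd; lra.
  pose b := A + i.+1%:R * d; pose c := A + i.+2%:R * d.
  (* The width of the gap: at most quadratic in d, and less than a part. *)
  pose eta := Num.min (d ^+ 2) (d / 2).
  have eta0 : 0 < eta by rewrite lt_min exprn_gt0 //= divr_gt0.
  have eta1 : eta <= d ^+ 2 by rewrite ge_min lexx.
  have eta2 : eta <= d / 2 by rewrite ge_min lexx orbT.
  have bc : c = b + d by rewrite /c /b -[i.+2%:R]natr1 mulrDl mul1r addrA.
  have Ab : A < b by rewrite /b ltrDl mulr_gt0.
  have cB : c <= B.
    have : i.+2%:R * d <= N.+1%:R * d by rewrite ler_wpM2r ?ler_nat // ltW.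
    by rewrite Nd /c; lra.
  have bb' : b < b + eta by rewrite ltrDl.
  have b'c : b + eta < c by lra.
  apply: le_trans (sup A b (b + eta) c _ _ _ _ _) => //.
  have Ab' : A <= b + eta by lra.
  apply: le_trans (leeD (IH (ltnW iN)) (loc (b + eta) c Ab' b'c cB)).
  rewrite -/b -/c -EFinD lee_fin -mulrDr ler_wpM2l //.
  have h1 : (c - (b + eta)) ^+ 2 <= d ^+ 2.
    by rewrite lerXn2r ?nnegrE; lra.
  have h2 := ler_wpM2l C0 h1.
  have h3 := glip b (b + eta) bb'.
  rewrite -[i.+2%:R]natr1; move: eta1 h2 h3.
  set u := (c - _) ^+ 2; set v := d ^+ 2; set q := i.+1%:R.
  move: (g b) (g c) (g A) (g (b + eta)) => gb gc gA gbe.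
  have -> : (C + 1) * ((q + 1) * v) = (C + 1) * (q * v) + C * v + v by ring.
  lra.
have := key N (leqnn _); rewrite Nd [A + _]addrC subrK; apply: le_trans.
rewrite lee_fin le_eqVlt; apply/orP; left; apply/eqP.
by rewrite /d; field; rewrite nat1r gt_eqF.
Qed.

(** The law of cosines: both sides equal a^2 + b^2 - 2 a b <u, v>. *)
(** * Latitude bands *)

Lemma enorm_scaled_unit_sub_sqr (R : realType) (m : nat) (a b : R)
    (u v : 'rV[R]_m) : enorm u = 1 -> enorm v = 1 ->
  enorm (a *: u - b *: v) ^+ 2 = (a - b) ^+ 2 + a * b * enorm (u - v) ^+ 2.
Proof.
move=> u1 v1.
have E (x y : R) : enorm (x *: u - y *: v) ^+ 2 =
    x ^+ 2 + y ^+ 2 - 2 * x * y * \sum_i u 0 i * v 0 i.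
  have -> : x ^+ 2 = \sum_i x ^+ 2 * u 0 i ^+ 2.
    by rewrite -mulr_sumr -enorm_sqr u1 expr1n mulr1.
  have -> : y ^+ 2 = \sum_i y ^+ 2 * v 0 i ^+ 2.
    by rewrite -mulr_sumr -enorm_sqr v1 expr1n mulr1.
  rewrite enorm_sqr mulr_sumr -big_split -sumrB /=.
  by apply: eq_bigr => i _; rewrite !mxE; ring.
have := E 1 1; rewrite !scale1r => ->; rewrite E; ring.
Qed.

Lemma scalar_mxB (R : realType) (a b : R) :
  a%:M - b%:M = (a - b)%:M :> 'M[R]_1.
Proof. by rewrite raddfB. Qed.

(** The point of R^k x S^(n+1) with spectator coordinate x, latitude t and
horizontal direction u, for p = (t, x, u). *)
Definition cylinder_pt (R : realType) (k n : nat)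
    (p : R * 'rV[R]_k * 'rV[R]_n.+1) : 'rV[R]_(k + (1 + n.+1)) :=
  row_mx p.1.2 (row_mx (sin p.1.1)%:M (cos p.1.1 *: p.2)).

(** The band around latitude t, unrolled to a product of a segment, a cube and
the sphere of radius [rho]. *)
Definition flat_pt (R : realType) (k n : nat) (rho a : R)
    (p : R * 'rV[R]_k * 'rV[R]_n.+1) : 'rV[R]_((1 + k) + n.+1) :=
  row_mx (row_mx (p.1.1 - a)%:M p.1.2) (rho *: p.2).

Definition slab (R : realType) (k n : nat) (a b : R)
    : set (R * 'rV[R]_k * 'rV[R]_n.+1) :=
  [set p | [/\ a <= p.1.1 <= b, unit_cube R k p.1.2 & sphere n 1 p.2]].
Arguments slab {R} k n a b.

Lemma cylinder_pt_dist (R : realType) (k n : nat)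
    (p q : R * 'rV[R]_k * 'rV[R]_n.+1) : enorm p.2 = 1 -> enorm q.2 = 1 ->
  enorm (cylinder_pt p - cylinder_pt q) ^+ 2 =
  enorm (p.1.2 - q.1.2) ^+ 2 +
  ((sin p.1.1 - sin q.1.1) ^+ 2 + (cos p.1.1 - cos q.1.1) ^+ 2) +
  cos p.1.1 * cos q.1.1 * enorm (p.2 - q.2) ^+ 2.
Proof.
move=> p1 q1; rewrite /cylinder_pt !row_mxB !enorm_row_mx_sqr.
rewrite scalar_mxB enorm_scalar_sqr enorm_scaled_unit_sub_sqr //.
by rewrite !addrA.
Qed.

Lemma flat_pt_dist (R : realType) (k n : nat) (rho a : R)
    (p q : R * 'rV[R]_k * 'rV[R]_n.+1) :
  enorm (flat_pt rho a p - flat_pt rho a q) ^+ 2 =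
  enorm (p.1.2 - q.1.2) ^+ 2 + (p.1.1 - q.1.1) ^+ 2 +
  rho ^+ 2 * enorm (p.2 - q.2) ^+ 2.
Proof.
rewrite /flat_pt !row_mxB !enorm_row_mx_sqr scalar_mxB enorm_scalar_sqr.
rewrite -scalerBr enormZ exprMn real_normK ?num_real //.
by rewrite opprB addrA subrK [_ ^+ 2 + enorm _ ^+ 2]addrC.
Qed.

(** The dilation of ratio 1 / rho turns the unrolled band into the product of a
box of sides (b - a) / rho, 1 / rho, ..., 1 / rho and the unit sphere. *)
Lemma hausdorff_measure_flat (R : realType) (k n : nat) (kappa rho a b : R) :
  hausdorff_measure (k.+1 + n) (row_prod (unit_cube R k.+1) (sphere n 1)) =
    kappa%:E -> 0 < rho -> a < b ->
  hausdorff_measure (k.+1 + n) (flat_pt rho a @` slab k n a b) =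
    (rho ^+ n * (b - a) * kappa)%:E.
Proof.
move=> Hk rho0 ab.
have rV : 0 < rho^-1 by rewrite invr_gt0.
pose psi (p : R * 'rV[R]_k * 'rV[R]_n.+1) : 'rV[R]_((1 + k) + n.+1) :=
  row_mx (row_mx (rho^-1 * (p.1.1 - a))%:M (rho^-1 *: p.1.2)) p.2.
rewrite (@hausdorff_measure_similar _ _ _ _ _ rho _ _ psi) //; last first.
  move=> p q _ _.
  have -> : flat_pt rho a p - flat_pt rho a q = rho *: (psi p - psi q).
    rewrite scalerBr /flat_pt /psi !scale_row_mx !scale_scalar_mx !scalerA.
    by rewrite mulrA mulfV ?gt_eqF // !scale1r mul1r mulrA mulfV ?gt_eqF // mul1r.
  by rewrite enormZ gtr0_norm.
pose l (i : 'I_(1 + k)) : R := if fintype.split i is inl _ then (b - a) / rho else rho^-1.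
have lL j : l (lshift k j) = (b - a) / rho.
  by rewrite /l -[lshift k j]/(unsplit (inl j)) unsplitK.
have lR j : l (rshift 1 j) = rho^-1.
  by rewrite /l -[rshift 1 j]/(unsplit (inr j)) unsplitK.
have -> : psi @` slab k n a b = row_prod (cbox l) (sphere n 1).
  apply/seteqP; split=> [_ [[[t x] u] /= [tab cx su] <-]|].
    exists (row_mx (rho^-1 * (t - a))%:M (rho^-1 *: x), u) => //.
    split=> //= i; case: (@split_ordP 1 k i) => j ->.
      rewrite lL row_mxEl mxE ord1 eqxx mulr1n; case/andP: tab => h1 h2.
      rewrite mulrC mulr_ge0 ?subr_ge0 ?(ltW rV) //=.
      by rewrite ler_wpM2r ?lerD2r // ltW.
    rewrite lR row_mxEr mxE; have /andP[h1 h2] := cx j.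
    by rewrite mulr_ge0 ?(ltW rV) //= ler_piMr // ltW.
  move=> _ [[y u] /= [yl su] <-].
  exists (rho * y 0 (lshift k (0 : 'I_1)) + a, rho *: @rsubmx R 1 1 k y, u) => /=.
    split=> //=.
      have := yl (lshift k (0 : 'I_1)); rewrite lL => /andP[h1 h2].
      rewrite lerDr mulr_ge0 ?(ltW rho0) //=.
      by rewrite -lerBrDr mulrC -ler_pdivlMr.
    move=> i; have := yl (rshift 1 i); rewrite lR !mxE => /andP[h1 h2].
    rewrite mulr_ge0 ?(ltW rho0) //=.
    by rewrite mulrC -ler_pdivlMr // div1r.
  rewrite /psi /= addrK mulrA mulVf ?gt_eqF // mul1r scalerA mulVf ?gt_eqF // scale1r.
  congr row_mx; rewrite -[RHS]hsubmxK; congr row_mx.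
  by apply/matrixP => i j; rewrite !ord1 !mxE.
rewrite hausdorff_measure_box; last first.
  move=> i; case: (@split_ordP 1 k i) => j ->; rewrite ?lL ?lR //.
  by rewrite divr_gt0 // subr_gt0.
rewrite Hk -!EFinM; congr (_%:E).
rewrite (@big_split_ord _ _ _ 1 k) /= big_ord1 lL (eq_bigr (fun=> rho^-1)) //.
rewrite prodr_const card_ord addSn exprS exprD.
have -> : rho^-1 ^+ k = (rho ^+ k)^-1 by rewrite exprVn.
have : rho ^+ k != 0 by rewrite expf_neq0 // gt_eqF.
have : rho != 0 by rewrite gt_eqF.
move: (rho ^+ k) (rho ^+ n) => x y r0 x0.
by field; rewrite r0 x0.
Qed.

(** The unrolled band of radius [M] is mapped onto the band by a map that does
not increase distances.  As the unrolled radius is the largest one of the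
band, this holds up to the poles, where the cosine vanishes. *)
Lemma band_upper_bound (R : realType) (k n : nat) (kappa M a b : R) :
  hausdorff_measure (k.+1 + n) (row_prod (unit_cube R k.+1) (sphere n 1)) =
    kappa%:E -> 0 < M -> a < b ->
  (forall t, a <= t <= b -> 0 <= cos t <= M) ->
  (hausdorff_measure (k.+1 + n) (@cylinder_pt R k n @` slab k n a b) <=
   (M ^+ n * (b - a) * kappa)%:E)%E.
Proof.
move=> Hk M0 ab cM; rewrite -(hausdorff_measure_flat Hk M0 ab).
have := @hausdorff_measure_lipschitz R _ _ _ (k.+1 + n) 1 (slab k n a b)
  (@cylinder_pt R k n) (flat_pt M a) ltr01.
rewrite expr1n mul1e; apply=> p q [tp _ sp] [tq _ sq]; rewrite mul1r.
apply: ler_enorm; rewrite cylinder_pt_dist // flat_pt_dist.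
apply: lerD; first by rewrite lerD2l chord_le.
rewrite ler_wpM2r ?sqr_ge0 // expr2.
have /andP[h1 h2] := cM _ tp; have /andP[h3 h4] := cM _ tq.
exact: ler_pM.
Qed.

(** Unrolling the band increases distances by a factor at most 1 / lam: the
latitudes because the chord is at least 1 - |s - t| times the arc, and the
horizontal directions because lam * rho <= cos t. *)
Lemma band_lower_bound (R : realType) (k n : nat) (kappa rho lam a b : R) :
  hausdorff_measure (k.+1 + n) (row_prod (unit_cube R k.+1) (sphere n 1)) =
    kappa%:E -> 0 < rho -> a < b -> b - a <= 1 - lam -> 0 < lam ->
  (forall t, a <= t <= b -> lam * rho <= cos t) ->
  ((lam ^+ (k.+1 + n) * (rho ^+ n * (b - a) * kappa))%:E <=
   hausdorff_measure (k.+1 + n) (@cylinder_pt R k n @` slab k n a b))%E.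
Proof.
move=> Hk rho0 ab abl lam0 cM.
rewrite EFinM -(hausdorff_measure_flat Hk rho0 ab).
rewrite muleC -lee_pdivlMr ?exprn_gt0 // muleC -exprVn.
apply: hausdorff_measure_lipschitz; first by rewrite invr_gt0.
move=> p q [tp _ sp] [tq _ sq].
rewrite mulrC ler_pdivlMr // -(@ler_sqr R); last 2 first.
- by rewrite nnegrE mulr_ge0 ?enorm_ge0 ?ltW.
- by rewrite nnegrE enorm_ge0.
rewrite exprMn cylinder_pt_dist // flat_pt_dist mulrC !mulrDr.
have lam1 : lam <= 1 by lra.
apply: lerD; first apply: lerD.
- rewrite ler_piMl ?sqr_ge0 // expr_le1 // ltW //.
- rewrite -exprMn -[lam](subKr 1); apply: chord_ge; last by lra.
  case/andP: tp => h1 h2; case/andP: tq => h3 h4.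
  by rewrite ler_norml; apply/andP; split; lra.
rewrite mulrA ler_wpM2r ?sqr_ge0 // -exprMn expr2.
have lr : 0 <= lam * rho by rewrite mulr_ge0 // ltW.
by apply: ler_pM => //; apply: cM.
Qed.

(** The latitude of (s, w) is the arcsine of s; at the poles the horizontal
direction is undetermined and an arbitrary unit vector is taken. *)
(** * The volume of the sphere *)

Lemma cylinder_pt_onto (R : realType) (k n : nat) :
  row_prod (unit_cube R k) (sphere n.+1 1) =
  @cylinder_pt R k n @` slab k n (- (pi / 2)) (pi / 2).
Proof.
apply/seteqP; split=> [_ [[x v] /= [cx sv] <-]|]; last first.
  move=> _ [[[t x] u] /= [tpi cx su] <-].
  exists (x, row_mx (sin t)%:M (cos t *: u)) => //; split=> //=.
  apply/eqP; rewrite -(@eqrXn2 _ 2) ?enorm_ge0 //.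
  rewrite (@enorm_row_mx_sqr R 1 n.+1) enorm_scalar_sqr enormZ exprMn.
  by rewrite real_normK ?num_real // (su : enorm u = 1) expr1n mulr1 addrC cos2Dsin2 ?expr1n.
pose s := v 0 (lshift n.+1 (0 : 'I_1)); pose w := @rsubmx R 1 1 n.+1 v.
have vE : v = row_mx (s%:M : 'rV_1) w.
  have -> : s%:M = @lsubmx R 1 1 n.+1 v.
    by apply/matrixP => i j; rewrite !ord1 !mxE eqxx.
  by rewrite /w hsubmxK.
have sw : s ^+ 2 + enorm w ^+ 2 = 1.
  rewrite -enorm_scalar_sqr -(@enorm_row_mx_sqr R 1 n.+1) -vE.
  by rewrite (sv : enorm v = 1) expr1n.
have s1 : -1 <= s <= 1.
  rewrite -ler_norml -(@ler_sqr R) ?nnegrE // real_normK ?num_real // expr1n.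
  by have := sqr_ge0 (enorm w); lra.
have cE : cos (asin s) = enorm w.
  rewrite cos_asin // -[RHS](ger0_norm (enorm_ge0 w)) -sqrtr_sqr; congr Num.sqrt.
  by lra.
have tpi : - (pi / 2) <= asin s <= pi / 2 by rewrite asin_geNpi2 ?asin_lepi2.
have sinE : sin (asin s) = s by rewrite asinK // in_itv.
have [w0|w0] := eqVneq (enorm w) 0.
  exists (asin s, x, delta_mx 0 0) => /=.
    split=> //=; rewrite /sphere /esphere /= /enorm (bigD1 ord0) //= big1.
      by rewrite mxE !eqxx expr1n addr0 sqrtr1.
    by move=> i i0; rewrite mxE eqxx (negbTE i0) expr0n.
  rewrite /cylinder_pt /= vE sinE cE w0 scale0r; congr (row_mx _ (row_mx _ _)).
  apply/matrixP => i j; rewrite ord1 [LHS]mxE; apply/esym/eqP.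
  by rewrite -normr_le0 -w0 coord_le_enorm.
exists (asin s, x, (enorm w)^-1 *: w) => /=.
  split=> //=; rewrite /sphere /esphere /= enormZ normfV.
  by rewrite ger0_norm ?enorm_ge0 // mulVf.
by rewrite /cylinder_pt /= vE sinE cE scalerA mulfV // scale1r.
Qed.

Lemma image_slab_subU (R : realType) (k n m : nat) (a b c : R)
    (f : R * 'rV[R]_k * 'rV[R]_n.+1 -> 'rV[R]_m) :
  f @` slab k n a c `<=` f @` slab k n a b `|` f @` slab k n b c.
Proof.
move=> _ [p [/andP[h1 h2] cp sp] <-]; have [pb|bp] := leP p.1.1 b.
  by left; exists p => //; split=> //; rewrite h1.
by right; exists p => //; split=> //; rewrite (ltW bp).
Qed.

Lemma cylinder_upper_bound (R : realType) (k n : nat) (kappa : R) :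
  0 <= kappa ->
  hausdorff_measure (k.+1 + n) (row_prod (unit_cube R k.+1) (sphere n 1)) =
    kappa%:E ->
  (hausdorff_measure (k.+1 + n) (row_prod (unit_cube R k) (sphere n.+1 1)) <=
   (kappa * wallis R n)%:E)%E.
Proof.
move=> k0 Hk; rewrite cylinder_pt_onto; have pi0 := pi_gt0 R.
apply: (@interval_upper_bound R (fun a b => hausdorff_measure (k.+1 + n)
    (@cylinder_pt R k n @` slab k n a b)) (cos_primitive n) _ _
    (n%:R * (1 + pi) ^+ n)); first by lra.
  move=> a b c _ ab bc _; apply: le_trans (hausdorff_measureU _ _ _).
  by apply: le_hausdorff_measure; exact: image_slab_subU.
move=> a b Aa ab bB.
have [xi /andP[x1 x2] xE] := cos_primitive_mean_value n (ltW ab).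
have c0 t : a <= t <= b -> 0 <= cos t.
  by move=> /andP[t1 t2]; apply: cos_ge0_pihalf; apply/andP; split; lra.
have cx0 : 0 <= cos xi by apply: c0; rewrite x1.
apply: (le_trans (@band_upper_bound R k n kappa (cos xi + (b - a)) a b Hk _ ab _)).
- by lra.
- move=> t tab; rewrite c0 //=; have := cos_lipschitz t xi.
  move: tab => /andP[t1 t2].
  have : `|t - xi| <= b - a by rewrite ler_norml; apply/andP; split; lra.
  by move=> h1 /le_trans-/(_ _ h1); rewrite ler_norml => /andP[_]; lra.
rewrite lee_fin mulrC ler_wpM2l // xE.
have H : (cos xi + (b - a)) ^+ n <= cos xi ^+ n + n%:R * (1 + pi) ^+ n * (b - a).
  by apply: exprD_le; [rewrite cx0 cos_le1 | apply/andP; split; lra].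
apply: le_trans (ler_wpM2r _ H) _; first by lra.
by rewrite expr2 mulrDl !mulrA.
Qed.

(** Near the poles the distortion of a band is not uniformly small, so two polar
caps of angular size [eta] are removed; they account for at most 2 eta in the
integral of the cosine power, and [eta] tends to 0. *)
Lemma cylinder_lower_bound (R : realType) (k n : nat) (kappa : R) :
  0 <= kappa ->
  hausdorff_measure (k.+1 + n) (row_prod (unit_cube R k.+1) (sphere n 1)) =
    kappa%:E ->
  ((kappa * wallis R n)%:E <=
   hausdorff_measure (k.+1 + n) (row_prod (unit_cube R k) (sphere n.+1 1)))%E.
Proof.
move=> k0 Hk; have pi0 := pi_gt0 R.
have glip (a b : R) : a < b -> cos_primitive n b - cos_primitive n a <= b - a.
  move=> ab; have [xi _ ->] := cos_primitive_mean_value n (ltW ab).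
  apply: ler_piMl; first by lra.
  apply: (le_trans (ler_norm _)); rewrite normrX.
  by rewrite exprn_ile1 // cos_max.
apply: (@le_of_sub_invn_le _ _ (kappa * pi)) => N.
have N0 : 0 < N.+1%:R :> R by [].
(* N.+2 rather than N.+1 makes eta < pi / 2 strict, so that A < B below. *)
pose eta : R := pi / 2 / N.+2%:R.
have eta0 : 0 < eta by rewrite !divr_gt0.
have eta1 : eta < pi / 2.
  by rewrite /eta ltr_pdivrMr // ltr_pMr ?ltr1n // divr_gt0.
have eta2 : eta <= pi / 2 / N.+1%:R.
  rewrite /eta; apply: ler_wpM2l; first by rewrite divr_ge0 // ltW.
  by rewrite lef_pV2 ?posrE // ler_nat.
pose A := - (pi / 2) + eta; pose B := pi / 2 - eta.
have [m m0 cm] : exists2 m : R, 0 < m & forall t : R, A <= t <= B -> m <= cos t.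
  exists (cos B); first by apply: cos_gt0_pihalf; rewrite /B; lra.
  move=> t /andP[t1 t2]; rewrite -[leRHS]cos_norm leNgt.
  rewrite ltr_cos ?in_itv /= ?normr_ge0 //=; last 2 first.
  - by apply/andP; split; rewrite /B; lra.
  - by rewrite ler_norml; apply/andP; split; rewrite /A /B in t1 t2 *; lra.
  by rewrite -leNgt ler_norml; apply/andP; split; rewrite /A /B in t1 t2 *; lra.
apply: (@le_trans _ _ (kappa * (cos_primitive n B - cos_primitive n A))%:E).
  rewrite lee_fin -mulrA -mulrBr ler_wpM2l // /wallis.
  have h1 : cos_primitive n A - cos_primitive n (- (pi / 2)) <= eta.
    rewrite -[leRHS](_ : A - - (pi / 2) = eta); last by rewrite /A; ring.
    by apply: glip; rewrite /A; lra.
  have h2 : cos_primitive n (pi / 2) - cos_primitive n B <= eta.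
    rewrite -[leRHS](_ : pi / 2 - B = eta); last by rewrite /B; ring.
    by apply: glip; rewrite /B; lra.
  have e3 : pi / N.+1%:R = 2 * (pi / 2 / N.+1%:R) :> R.
    by field; rewrite nat1r gt_eqF.
  rewrite e3; move: h1 h2 eta2; move: (_ / N.+1%:R) => q.
  clear; move: (cos_primitive n A) (cos_primitive n B) => x y; lra.
rewrite cylinder_pt_onto.
apply: (@le_trans _ _ (hausdorff_measure (k.+1 + n) (@cylinder_pt R k n @` slab k n A B))); last first.
  apply: le_hausdorff_measure => _ [p [/andP[h1 h2] cp sp] <-]; exists p => //.
  by split=> //; apply/andP; split; rewrite /A /B in h1 h2; lra.
pose s := (k.+1 + n)%N.
apply: (@interval_lower_bound R (fun a b => hausdorff_measure s
    (@cylinder_pt R k n @` slab k n a b)) (cos_primitive n) _ _ (s%:R / m)) => //.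
- by rewrite /A /B; lra.
- by rewrite divr_ge0 // ltW.
- move=> a b b' c Aa ab bb' b'c cB.
  apply: (@le_trans _ _ (hausdorff_measure s
     (@cylinder_pt R k n @` slab k n a b `|` @cylinder_pt R k n @` slab k n b' c))).
    apply: (@hausdorff_measure_separated _ _ _ (sin b' - sin b)).
      by rewrite subr_gt0 ltr_sin // in_itv /=; apply/andP; split; rewrite /A /B in Aa cB; lra.
    move=> _ _ [p [/andP[p1 p2] _ _] <-] [q [/andP[q1 q2] _ _] <-].
    have := coord_le_enorm (cylinder_pt p - cylinder_pt q) (rshift k (lshift n.+1 (0 : 'I_1))).
    rewrite /cylinder_pt !row_mxB row_mxEr scalar_mxB row_mxEl mxE eqxx mulr1n.
    apply: le_trans.
    have h1 : sin p.1.1 <= sin b.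
      rewrite leNgt ltr_sin ?in_itv /= -?leNgt //; apply/andP; split; rewrite /A /B in Aa cB; lra.
    have h2 : sin b' <= sin q.1.1.
      rewrite leNgt ltr_sin ?in_itv /= -?leNgt //; apply/andP; split; rewrite /A /B in Aa cB; lra.
    have h3 : sin b < sin b'.
      by rewrite ltr_sin // in_itv /=; apply/andP; split; rewrite /A /B in Aa cB; lra.
    by rewrite ler0_norm; lra.
  apply: le_hausdorff_measure => _ [|] [p [/andP[h1 h2] cp sp] <-]; exists p => //.
    by split=> //; apply/andP; split; lra.
  by split=> //; apply/andP; split; lra.
move=> a b Aa ab bB.
have [xi /andP[x1 x2] xE] := cos_primitive_mean_value n (ltW ab).
have mxi : m <= cos xi by apply: cm; apply/andP; split; lra.
have rho0 : 0 < cos xi by apply: lt_le_trans mxi.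
have cn : cos xi ^+ n <= 1 by rewrite exprn_ile1 ?cos_le1 // ltW.
have cn0 : 0 <= cos xi ^+ n by rewrite exprn_ge0 // ltW.
have m1 : m <= 1 by apply: le_trans (cos_le1 xi).
have ba0 : 0 < b - a by lra.
have s1 : 1 <= s%:R :> R by rewrite ler1n.
rewrite xE.
(* On a band wider than m the quadratic error exceeds the main term. *)
have [bam|mba] := ltP (b - a) m; last first.
  apply: (@le_trans _ _ 0%E); last exact: hausdorff_measure_ge0.
  rewrite lee_fin mulr_ge0_le0 // subr_le0 expr2 mulrA ler_wpM2r ?(ltW ba0) //.
  apply: (le_trans cn); rewrite mulrAC ler_pdivlMr // mul1r.
  by apply: (le_trans mba); rewrite ler_peMl // ltW.
pose d := (b - a) / m; pose lam := 1 - d.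
have d0 : 0 < d by rewrite divr_gt0.
have d1 : d < 1 by rewrite ltr_pdivrMr // mul1r.
have bad : b - a <= d by rewrite ler_pdivlMr // ler_piMr // ltW.
have lam0 : 0 < lam by rewrite subr_gt0.
apply: le_trans (@band_lower_bound R k n kappa (cos xi) lam a b Hk rho0 ab _ lam0 _); last 2 first.
- by rewrite /lam; lra.
- move=> t /andP[t1 t2]; have := cos_lipschitz t xi.
  have h1 : `|t - xi| <= b - a by rewrite ler_norml; apply/andP; split; lra.
  move=> /le_trans-/(_ _ h1); rewrite ler_norml => /andP[h2 _].
  have : b - a <= d * cos xi by rewrite /d mulrAC ler_pdivlMr // ler_wpM2l // ltW.
  by rewrite /lam mulrBl mul1r; lra.
rewrite lee_fin -/s.
have -> : lam ^+ s * (cos xi ^+ n * (b - a) * kappa) =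
  kappa * (lam ^+ s * (cos xi ^+ n * (b - a))) by ring.
apply: ler_wpM2l => //.
(* The Bernoulli inequality makes the distortion of order b - a. *)
have bern : 1 - s%:R * d <= lam ^+ s.
  rewrite /lam; elim: (s) => [|j IH]; first by rewrite mul0r subr0 expr0.
  rewrite exprS; apply: (@le_trans _ _ ((1 - d) * (1 - j%:R * d))).
    by rewrite -natr1 -subr_ge0; have := mulr_ge0 (ler0n R j) (sqr_ge0 d); lra.
  by rewrite ler_wpM2l // ltW.
pose y := cos xi ^+ n * (b - a).
have y0 : 0 <= y by rewrite mulr_ge0 // ltW.
have yba : y <= b - a by rewrite ler_piMl // ltW.
have -> : s%:R / m * (b - a) ^+ 2 = s%:R * d * (b - a) by rewrite /d; field; rewrite gt_eqF.
have h1 := ler_wpM2r y0 bern.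
have sd0 : 0 <= s%:R * d by rewrite mulr_ge0 // ltW.
have h2 := ler_wpM2l sd0 yba.
apply: le_trans h1; rewrite -/y mulrBl mul1r; lra.
Qed.

Lemma enorm_rV1 (R : realType) (x : 'rV[R]_1) : enorm x = `|x 0 0|.
Proof. by rewrite /enorm big_ord1 sqrtr_sqr. Qed.

(** The 0-sphere consists of two points at distance 2. *)
Lemma hausdorff_measure_cylinder0 (R : realType) (k : nat) :
  hausdorff_measure k (row_prod (unit_cube R k) (sphere 0 1)) =
  (2%:E * hausdorff_measure k (unit_cube R k))%E.
Proof.
pose S (e : R) : set 'rV[R]_(k + 1) :=
  (fun x => row_mx x (e%:M : 'rV_1)) @` unit_cube R k.
have HS e : hausdorff_measure k (S e) = hausdorff_measure k (unit_cube R k).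
  rewrite (@hausdorff_measure_isometric _ _ _ k _ _ _ id) ?image_id // => x y _ _.
  apply/eqP; rewrite -(@eqrXn2 _ 2) ?enorm_ge0 //.
  by rewrite row_mxB enorm_row_mx_sqr subrr enorm0 expr0n addr0.
have e1 (e : R) : (e%:M : 'rV[R]_1) 0 0 = e by rewrite mxE eqxx.
have -> : row_prod (unit_cube R k) (sphere 0 1) = S 1 `|` S (-1).
  apply/seteqP; split=> [_ [[x u] /= [cx su] <-]|_ [|] [x cx <-]].
  - have uE : u = (u 0 0)%:M by rewrite [LHS]mx11_scalar.
    move: su; rewrite /sphere /esphere /= enorm_rV1.
    have [h0 u1|h0 u1] := leP 0 (u 0 0); [left|right]; exists x => //; rewrite uE -u1.
      by rewrite ger0_norm.
    by rewrite ltr0_norm // opprK.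
  - by exists (x, 1%:M) => //; split=> //; rewrite /sphere /esphere /= enorm_rV1 e1 normr1.
  - by exists (x, (-1)%:M) => //; split=> //; rewrite /sphere /esphere /= enorm_rV1 e1 normrN1.
rewrite (_ : 2%:E = 1 + 1)%E // ge0_muleDl // mul1e -{1}(HS 1) -(HS (-1)).
apply/eqP; rewrite eq_le hausdorff_measureU /=.
apply: (@hausdorff_measure_separated _ _ _ 2) => // _ _ [x cx <-] [y cy <-].
have := coord_le_enorm (row_mx x (1%:M : 'rV_1) - row_mx y (-1)%:M) (rshift k 0).
by rewrite row_mxB row_mxEr scalar_mxB e1 opprK ger0_norm.
Qed.

(** The volume of the unit n-sphere obtained from latitude bands. *)
Definition sphere_const (R : realType) (n : nat) : R := 2 * \prod_(i < n) wallis R i.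
Arguments sphere_const R n : clear implicits.

(** The spectator cube makes the induction possible: the interval of latitudes
becomes an additional side of the cube when passing from S^(n+1) to S^n.  The
exponent is kept as a separate variable because the two ways of writing it,
k + (n + 1) and (k + 1) + n, index different matrix types. *)
Lemma hausdorff_measure_cylinder (R : realType) (n k s : nat) : s = (k + n)%N ->
  hausdorff_measure s (row_prod (unit_cube R k) (sphere n 1)) =
  ((sphere_const R n)%:E * hausdorff_measure s (unit_cube R s))%E.
Proof.
elim: n k s => [|n IH] k s.
  by rewrite addn0 => ->; rewrite hausdorff_measure_cylinder0 /sphere_const big_ord0 mulr1.
rewrite -addSnnS => sE; have := IH k.+1 s sE; rewrite {s}sE.
have c0 := hausdorff_measure_ge0 (k.+1 + n) (unit_cube R (k.+1 + n)).
have cy := hausdorff_measure_unit_cube_lty R (k.+1 + n).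
have fc : hausdorff_measure (k.+1 + n) (unit_cube R (k.+1 + n)) \is a fin_num.
  by rewrite ge0_fin_numE.
rewrite -(fineK fc) -EFinM => Hk.
set c := fine _ in Hk.
have k0 : 0 <= sphere_const R n * c.
  rewrite mulr_ge0 ?fine_ge0 // /sphere_const mulr_ge0 // prodr_ge0 // => i _.
  exact/ltW/wallis_gt0.
rewrite /sphere_const big_ord_recr /= mulrA -/(sphere_const R n).
rewrite -EFinM mulrAC; apply/eqP; rewrite eq_le.
by rewrite cylinder_upper_bound //= cylinder_lower_bound.
Qed.

Lemma hausdorff_measure_sphere (R : realType) (n : nat) (r : R) : 0 < r ->
  hausdorff_measure n (sphere n r) =
  ((r ^+ n * sphere_const R n)%:E * hausdorff_measure n (unit_cube R n))%E.
Proof.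
move=> r0.
have -> : sphere n r = ( *:%R r) @` sphere n (1 : R).
  apply/seteqP; split=> [x xr|_ [x x1 <-]]; last first.
    by rewrite /sphere /esphere /= enormZ (x1 : enorm x = 1) mulr1 gtr0_norm.
  exists (r^-1 *: x); last by rewrite scalerA mulfV ?scale1r // gt_eqF.
  rewrite /sphere /esphere /= enormZ (xr : enorm x = r) normfV gtr0_norm //.
  by rewrite mulVf // gt_eqF.
rewrite EFinM -muleA -(@hausdorff_measure_cylinder R n 0) //.
rewrite (@hausdorff_measure_similar _ _ _ (0 + n.+1) n r (sphere n 1) ( *:%R r) (row_mx 0)) //.
  congr (_ * hausdorff_measure _ _)%E.
  apply/seteqP; split=> [_ [u su <-]|_ [[x u] /= [_ su] <-]].
    by exists (0, u) => //; split=> // -[].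
  by exists u => //; rewrite [x]thinmx0.
move=> x y _ _; rewrite -scalerBr enormZ gtr0_norm //; congr (_ * _).
apply/eqP; rewrite -(@eqrXn2 _ 2) ?enorm_ge0 //.
by rewrite row_mxB enorm_row_mx_sqr subrr enorm0 expr0n add0r.
Qed.

Lemma volume_sphere (R : realType) (n : nat) (r : R) : 0 < r ->
  volume n (sphere n r) = r ^+ n * sphere_const R n.
Proof.
move=> r0; rewrite /volume hausdorff_measure_sphere //.
have c0 := hausdorff_measure_unit_cube_gt0 R n.
have fc : hausdorff_measure n (unit_cube R n) \is a fin_num.
  by rewrite ge0_fin_numE ?ltW // hausdorff_measure_unit_cube_lty.
rewrite fineM // mulfK // gt_eqF // fine_gt0 // c0.
exact: hausdorff_measure_unit_cube_lty.
Qed.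

Lemma sphere_const_wallis (R : realType) (n : nat) :
  sphere_const R n * wallis R n = 2 * pi * ball_const R n.
Proof.
elim: n => [|n IH].
  by rewrite /sphere_const /ball_const !big_ord0 wallis0 !mulr1.
rewrite /sphere_const /ball_const !big_ord_recr /= -/(ball_const R n).
by rewrite [2 * pi * _]mulrA -IH /sphere_const !mulrA.
Qed.

Lemma ball_const_gt0 (R : realType) (n : nat) : 0 < ball_const R n.
Proof. by apply: prodr_gt0 => i _; exact: wallis_gt0. Qed.

Lemma sphere_ball_ratio (R : realType) (n : nat) :
  2 * pi / (n`!%:R * wallis R n) = sphere_const R n / (n`!%:R * ball_const R n).
Proof.
have w0 : wallis R n != 0 by rewrite gt_eqF ?wallis_gt0.
have b0 : ball_const R n != 0 by rewrite gt_eqF ?ball_const_gt0.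
have f0 : n`!%:R != 0 :> R by rewrite pnatr_eq0 -lt0n fact_gt0.
have -> : sphere_const R n = 2 * pi * ball_const R n / wallis R n.
  by rewrite -sphere_const_wallis mulfK.
by field; rewrite w0 b0 f0.
Qed.

(** The topology of matrices is the product topology of the entries. *)
(** * The Euler characteristic of the sphere *)

Lemma continuous_rV (R : realType) (T : topologicalType) (m : nat)
    (f : T -> 'rV[R]_m) :
  (forall j, continuous (fun x => f x 0 j)) -> continuous f.
Proof.
move=> cf x A [P fP sA].
apply: (@filterS _ _ _ (fun y => forall j, P 0 j (f y 0 j))).
  by move=> y Py; apply: sA => i j; rewrite ord1.
by apply: filter_forall => j; apply: cf; exact: fP.
Qed.

Lemma continuous_enorm_sqr (R : realType) (m : nat) :
  continuous (fun x : 'rV[R]_m => enorm x ^+ 2).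
Proof.
have -> : (fun x : 'rV[R]_m => enorm x ^+ 2) =
    (fun x => \sum_(i <- index_enum 'I_m) x 0 i ^+ 2).
  by apply/funext => x; rewrite enorm_sqr.
elim: (index_enum _) => [|i s IH] x.
  have -> : (fun x : 'rV[R]_m => \sum_(i <- [::]) x 0 i ^+ 2) = cst 0.
    by apply/funext => y; rewrite big_nil.
  exact: cst_continuous.
have -> : (fun x : 'rV[R]_m => \sum_(j <- i :: s) x 0 j ^+ 2) =
    (fun x : 'rV[R]_m => x 0 i ^+ 2) \+ (fun x => \sum_(j <- s) x 0 j ^+ 2).
  by apply/funext => y; rewrite big_cons.
have C : {for x, continuous (fun x : 'rV[R]_m => x 0 i ^+ 2)}.
  exact: (continuous_comp (@coord_continuous R 1 m 0 i x) (@exprn_continuous R 2 _)).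
exact: (continuousD C (IH x)).
Qed.

Definition pole (R : realType) (n : nat) : 'rV[R]_(1 + n) := row_mx (-1)%:M 0.
Arguments pole R n : clear implicits.

(** The closed ball is wrapped around the sphere: the centre goes to (1, 0), the
sphere of radius r to the latitude of height 1 - 2 r^2, and the whole boundary
to the opposite pole (-1, 0).  The factor 2 sqrt (1 - r^2) is the one that makes
the image have norm 1. *)
Definition wrap (R : realType) (n : nat) (x : 'rV[R]_n) : 'rV[R]_(1 + n) :=
  row_mx (1 - 2 * enorm x ^+ 2)%:M ((2 * Num.sqrt (1 - enorm x ^+ 2)) *: x).

Lemma continuous_wrap (R : realType) (n : nat) : continuous (@wrap R n).
Proof.
have c1 (a b : R) : continuous (fun x : 'rV[R]_n => a - b * enorm x ^+ 2).
  move=> x; have H := continuousM (@cst_continuous _ _ b x) (@continuous_enorm_sqr R n x).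
  exact: (continuousB (@cst_continuous _ _ a x) H).
apply: continuous_rV => j; case: (@split_ordP 1 n j) => i ->.
  rewrite (_ : (fun _ => _) = (fun x : 'rV[R]_n => 1 - 2 * enorm x ^+ 2)) //.
  by apply/funext => x; rewrite row_mxEl mxE ord1 eqxx.
rewrite (_ : (fun _ => _) = (fun x : 'rV[R]_n =>
    2 * Num.sqrt (1 - 1 * enorm x ^+ 2) * x 0 i)); last first.
  by apply/funext => x; rewrite row_mxEr mxE mul1r.
move=> x.
have H1 : {for x, continuous (fun x : 'rV[R]_n => Num.sqrt (1 - 1 * enorm x ^+ 2))}.
  by apply: (continuous_comp (c1 1 1 x)); exact: sqrt_continuous.
have H2 := continuousM (@cst_continuous _ _ (2 : R) x) H1.
exact: (continuousM H2 (@coord_continuous _ _ _ 0 i x)).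
Qed.

Lemma wrap_sphere (R : realType) (n : nat) (x : 'rV[R]_n) :
  enorm x <= 1 -> enorm (wrap x) = 1.
Proof.
move=> x1; apply/eqP; rewrite -(@eqrXn2 _ 2) ?enorm_ge0 //.
rewrite enorm_row_mx_sqr enorm_scalar_sqr enormZ exprMn real_normK ?num_real //.
rewrite exprMn (@sqr_sqrtr _ (1 - _)); last by rewrite subr_ge0 expr_le1 ?enorm_ge0.
by apply/eqP; ring.
Qed.

(** The first coordinate determines the norm, and then the remaining ones
determine the vector, as 1 - |x|^2 is positive inside the ball. *)
Lemma wrap_inj (R : realType) (n : nat) (x y : 'rV[R]_n) :
  enorm x < 1 -> enorm y < 1 -> wrap x = wrap y -> x = y.
Proof.
move=> x1 y1 /eq_row_mx [/matrixP/(_ 0 0)]; rewrite !mxE eqxx !mulr1n => e.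
have e2 : enorm x ^+ 2 = enorm y ^+ 2 by lra.
rewrite e2; apply: scalerI; rewrite mulf_neq0 // gt_eqF // sqrtr_gt0 subr_gt0.
by rewrite expr_lt1 ?enorm_ge0.
Qed.

Lemma wrap_boundary (R : realType) (n : nat) (x : 'rV[R]_n) :
  enorm x = 1 -> wrap x = pole R n.
Proof.
move=> x1; rewrite /wrap /pole x1 expr1n subrr sqrtr0 mulr0 scale0r.
by congr (row_mx _%:M _); lra.
Qed.

Lemma wrap_neq_pole (R : realType) (n : nat) (x : 'rV[R]_n) :
  enorm x < 1 -> wrap x <> pole R n.
Proof.
move=> x1 /eq_row_mx [/matrixP/(_ 0 0)]; rewrite !mxE eqxx !mulr1n => e _.
have : enorm x ^+ 2 < 1 by rewrite expr_lt1 ?enorm_ge0.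
lra.
Qed.

Lemma wrap_onto (R : realType) (n : nat) (v : 'rV[R]_(1 + n)) :
  enorm v = 1 -> v <> pole R n -> exists2 x, enorm x < 1 & wrap x = v.
Proof.
move=> v1 vN; pose a := v 0 (lshift n (0 : 'I_1)); pose w := rsubmx v.
have vE : v = row_mx (a%:M : 'rV_1) w.
  have -> : a%:M = lsubmx v by apply/matrixP => i j; rewrite !ord1 !mxE eqxx.
  by rewrite /w hsubmxK.
have aw : a ^+ 2 + enorm w ^+ 2 = 1.
  by rewrite -enorm_scalar_sqr -enorm_row_mx_sqr -vE v1 expr1n.
have a1 : -1 <= a <= 1.
  rewrite -ler_norml -(@ler_sqr R) ?nnegrE // real_normK ?num_real // expr1n.
  by have := sqr_ge0 (enorm w); lra.
have aN1 : a != -1.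
  apply/eqP => aN; apply: vN; rewrite vE aN /pole; congr row_mx.
  have w0 : enorm w = 0.
    by apply/eqP; rewrite -sqrf_eq0; apply/eqP; move: aw; rewrite aN; lra.
  apply/matrixP => i j; rewrite ord1 [RHS]mxE; apply/eqP.
  by rewrite -normr_le0 -w0 coord_le_enorm.
have aN : -1 < a by rewrite lt_neqAle eq_sym aN1; case/andP: a1.
case/andP: a1 => _ a1.
(* A preimage x has |x|^2 = (1 - a) / 2, whence the factor of wrap. *)
pose q := 2 * Num.sqrt ((1 + a) / 2).
have q2 : q ^+ 2 = 2 * (1 + a) by rewrite exprMn (@sqr_sqrtr _ (_ / 2)); lra.
have q0 : 0 < q by rewrite mulr_gt0 // sqrtr_gt0; lra.
have nx : enorm (q^-1 *: w) ^+ 2 = (1 - a) / 2.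
  rewrite enormZ exprMn real_normK ?num_real // exprVn q2.
  have -> : enorm w ^+ 2 = (1 - a) * (1 + a) by lra.
  by field; rewrite gt_eqF //; lra.
exists (q^-1 *: w).
  by rewrite -(@ltr_pXn2r _ 2) ?nnegrE ?enorm_ge0 // nx expr1n; lra.
rewrite [RHS]vE /wrap nx; congr (row_mx _ _); first by congr (_%:M); lra.
have -> : 1 - (1 - a) / 2 = (1 + a) / 2 by lra.
by rewrite scalerA -/q mulfV ?scale1r // gt_eqF.
Qed.

Definition cell_dim (n : nat) (i : 'I_2) : nat := if i == ord0 then 0%N else n.

Definition cell_map (R : realType) (n : nat) (i : 'I_2) :
    'rV[R]_(cell_dim n i) -> 'rV[R]_n.+1 :=
  if i == ord0 as b return 'rV[R]_(if b then 0%N else n) -> 'rV[R]_n.+1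
  then fun=> pole R n else @wrap R n.
Arguments cell_map R n i : clear implicits.

Lemma unit_vector_dim_gt0 (R : realType) (n : nat) (x : 'rV[R]_n) :
  enorm x = 1 -> (0 < n)%N.
Proof.
case: n x => [|n] // x; rewrite [x]thinmx0 enorm0 => /esym/eqP.
by rewrite oner_eq0.
Qed.

(** One 0-cell, the pole, and one n-cell, its complement.  For n = 0 the second
cell is the other point, and its boundary sphere in R^0 is empty. *)
Lemma sphere_cw_structure (R : realType) (n : nat) :
  finite_cw_structure (sphere n (1 : R)) (cell_map R n).
Proof.
pose i1 : 'I_2 := lift ord0 ord0.
have i2 (i : 'I_2) : i = ord0 \/ i = i1.
  by case: (unliftP ord0 i) => [j ->|->]; [right; rewrite ord1|left].
have E0 : cell_map R n ord0 @` open_unit_ball R (cell_dim n ord0) = [set pole R n].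
  apply/seteqP; split=> [_ [x _ <-] //|_ ->]; exists 0 => //.
  by rewrite /open_unit_ball /= enorm0.
have E1 : cell_map R n i1 @` open_unit_ball R (cell_dim n i1) =
    @wrap R n @` open_unit_ball R n by [].
split.
- move=> i; apply: continuous_subspaceT; case: (i2 i) => ->.
    exact: cst_continuous.
  exact: continuous_wrap.
- move=> i; case: (i2 i) => -> x y.
    by move=> _ _ _; rewrite [x]thinmx0 [y]thinmx0.
  by rewrite !inE => x1 y1; exact: wrap_inj.
- apply/seteqP; split=> [v sv|v [i _]].
    have [vp|vp] := pselect (v = pole R n).
      by exists ord0 => //; rewrite E0.
    exists i1 => //; rewrite E1.
    by have [x x1 xv] := wrap_onto sv vp; exists x.
  case: (i2 i) => ->.
    rewrite E0 => ->; rewrite /sphere /esphere /=; apply/eqP.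
    rewrite -(@eqrXn2 _ 2) ?enorm_ge0 // (@enorm_row_mx_sqr R 1 n).
    by rewrite enorm_scalar_sqr enorm0 expr0n addr0 sqrrN.
  by rewrite E1 => -[x x1 <-]; apply: wrap_sphere; exact: ltW.
- move=> i j _ _; case: (i2 i) => ->; case: (i2 j) => -> //.
    by rewrite E0 E1 => -[_ [-> [x x1 /wrap_neq_pole]]]; case.
  by rewrite E0 E1 => -[_ [[x x1 <-] /(wrap_neq_pole x1)]]; case.
move=> i; case: (i2 i) => -> _ [x x1 <-].
  move: x1; rewrite /esphere /= [x]thinmx0 enorm0 => /esym/eqP.
  by rewrite oner_eq0.
exists ord0; first exact: unit_vector_dim_gt0 x1.
by rewrite E0; exact: wrap_boundary.
Qed.

Lemma sphere_euler_characteristic (R : realType) (n : nat) :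
  is_euler_characteristic (sphere n (1 : R)) (1 + (-1) ^+ n).
Proof.
exists 2%N, (cell_dim n), (cell_map R n); split; first exact: sphere_cw_structure.
by rewrite big_ord_recl big_ord1 /= expr0.
Qed.

Theorem theorem8 (R : realType) (n : nat) :
  [/\ leading_term (magnitude_numerator R n)
        = (volume n (sphere n (1 : R)) / (n`!%:R * ball_volume R n)) *: 'X^n,
      forall r : R, 0 < r ->
        (leading_term (magnitude_numerator R n)).[r]
          = (n`!%:R * ball_volume R n)^-1 * volume n (sphere n r)
    & exists2 chi : int,
        is_euler_characteristic (sphere n (1 : R)) chi &
        (magnitude_numerator R n)`_0 = chi%:~R].
Proof.
rewrite leading_term_magnitude_numerator sphere_ball_ratio ball_volumeE; split.
- by rewrite volume_sphere // expr1n mul1r.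
- by move=> r r0; rewrite volume_sphere // hornerZ hornerXn mulrAC [RHS]mulrC [r ^+ n * _]mulrC.
- exists (1 + (-1) ^+ n); first exact: sphere_euler_characteristic.
  exact: magnitude_numerator_coef0.
Qed.
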